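(* Let $\Bbbk$ be a field of characteristic zero, let $A$ and $B$ be $\Bbbk$-algebras, and fix vector-space decompositions $A=\Bbbk 1_A\oplus A_0$ and $B=\Bbbk 1_B\oplus B_0$. There is an isomorphism of $\Bbbk$-vector spaces $$(A*B)_{\natural}\;\cong\;\frac{A_{\natural}\oplus B_{\natural}}{\Bbbk(\overline{1_A},-\overline{1_B})}\;\oplus\;\bigoplus_{r\geq1}\left((A_0\otimes B_0)^{\otimes r}\right)_{C_r},$$ where $C_r=\mathbb{Z}/r\mathbb{Z}$ cyclically permutes the $r$ tensor factors $A_0\otimes B_0$ and $(-)_{C_r}$ denotes coinvariants. Under this isomorphism: - for $a\in A$ (respectively, $b\in B$), the class of $a$ (respectively, $b$) in $(A*B)_{\natural}$ maps to the class of $(\overline a,0)$ (respectively, $(0,\overline b)$) in the quotient $\frac{A_{\natural}\oplus B_{\natural}}{\Bbbk(\overline{1_A},-\overline{1_B})}$; - for $r\ge 1$, $a_1,\ldots,a_r\in A_0$ and $b_1,\ldots,b_r\in B_0$, the class of $a_1b_1\cdots a_rb_r$ in $(A*B)_{\natural}$ maps to the coinvariant class of $(a_1\otimes b_1)\otimes\cdots\otimes(a_r\otimes b_r)$ in $\left((A_0\otimes B_0)^{\otimes r}\right)_{C_r}$.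
   Context: An algebra means a nonzero associative unital $\Bbbk$-algebra; tensor products are over $\Bbbk$. The cocenter of an algebra $C$ is the vector space $C_{\natural}:=C/[C,C]$, where $[C,C]$ is the $\Bbbk$-linear span of all commutators $xy-yx$ with $x,y\in C$; the class of $c\in C$ is denoted $\overline c$. The free product $A*B$ is the coproduct of $A$ and $B$ in the category of unital $\Bbbk$-algebras; elements of $A$ and $B$ are regarded as elements of $A*B$ via the canonical homomorphisms (which are injective). The decompositions $A=\Bbbk 1_A\oplus A_0$, $B=\Bbbk1_B\oplus B_0$ are arbitrary decompositions of vector spaces ($A_0$, $B_0$ are just linear complements, not assumed to be ideals or subalgebras). *)

(* Defs.v *)
From HB Require Import structures.
From mathcomp Require Import all_boot all_fingroup all_algebra.
From mathcomp Require Import boolp.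
From mathcomp Require Import generic_quotient freeg.

Set Implicit Arguments.
Unset Strict Implicit.
Unset Printing Implicit Defensive.

Import GRing.Theory.
Local Open Scope ring_scope.
Local Open Scope quotient_scope.

Section Span.
Variables (k : fieldType) (V : lmodType k) (X : V -> Prop).

Definition linear_span (v : V) : bool :=
  `[< exists n (c : 'I_n -> k) (x : 'I_n -> V),
        (forall i, X (x i)) /\ v = \sum_(i < n) c i *: x i >].

Lemma linear_span_incl x : X x -> x \in linear_span.
Proof.
move=> Xx; apply/asboolP; exists 1%N, (fun=> 1), (fun=> x); split=> //.
by rewrite big_ord1 scale1r.
Qed.

Lemma linear_span_submod : submod_closed linear_span.
Proof.
split.
  by apply/asboolP; exists 0%N, (fun=> 0), (fun=> 0); rewrite big_ord0; split=> // -[].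
move=> a u v /asboolP[m [c [x [Xx ->]]]] /asboolP[n [d [y [Xy ->]]]].
apply/asboolP; exists (m + n)%N.
exists (fun i => match split i with inl j => a * c j | inr j => d j end).
exists (fun i => match split i with inl j => x j | inr j => y j end); split.
  by move=> i; case: (split i).
rewrite big_split_ord scaler_sumr; congr (_ + _); apply: eq_bigr => i _ /=.
  by rewrite (unsplitK (inl i)) scalerA.
by rewrite (unsplitK (inr i)).
Qed.

HB.instance Definition _ :=
  GRing.isSubmodClosed.Build k V linear_span linear_span_submod.

Local Notation zquot := (@Quotient.quot V (GRing.ZmodClosed.clone V linear_span _)).

Definition quotv : Type := zquot.

HB.instance Definition _ := GRing.Zmodule.on quotv.

Definition quotv_class (v : V) : quotv := \pi_zquot v.

Lemma quotv_class_eq u v :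
  (quotv_class u == quotv_class v) = (u - v \in linear_span).
Proof. by rewrite Quotient.idealrBE eqmodE. Qed.

Lemma quotv_classP (q : quotv) : exists v, q = quotv_class v.
Proof. by exists (repr (q : zquot)); rewrite /quotv_class reprK. Qed.

Fact quotv_class_is_zmod_morphism : zmod_morphism quotv_class.
Proof. exact: (raddfB \pi_zquot). Qed.

HB.instance Definition _ :=
  GRing.isZmodMorphism.Build V quotv quotv_class quotv_class_is_zmod_morphism.

Definition quotv_scale (a : k) (q : quotv) : quotv :=
  quotv_class (a *: repr (q : zquot)).

Lemma quotv_scale_class a v :
  quotv_scale a (quotv_class v) = quotv_class (a *: v).
Proof.
apply/eqP; rewrite quotv_class_eq -scalerBr rpredZ // -quotv_class_eq.
by rewrite /quotv_class reprK.
Qed.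

Fact quotv_scaleA a b q : quotv_scale a (quotv_scale b q) = quotv_scale (a * b) q.
Proof. by case: (quotv_classP q) => v ->; rewrite !quotv_scale_class scalerA. Qed.

Fact quotv_scale1 : left_id 1 quotv_scale.
Proof.
by move=> q; case: (quotv_classP q) => v ->; rewrite quotv_scale_class scale1r.
Qed.

Fact quotv_scaleDr : right_distributive quotv_scale +%R.
Proof.
move=> a q r; case: (quotv_classP q) => u ->; case: (quotv_classP r) => v ->.
by rewrite -raddfD !quotv_scale_class scalerDr raddfD.
Qed.

Fact quotv_scaleDl q : {morph quotv_scale^~ q : a b / a + b}.
Proof.
move=> a b; case: (quotv_classP q) => v ->.
by rewrite !quotv_scale_class scalerDl raddfD.
Qed.

HB.instance Definition _ := GRing.Zmodule_isLmodule.Build k quotv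
  quotv_scaleA quotv_scale1 quotv_scaleDr quotv_scaleDl.

Fact quotv_class_is_scalable : scalable quotv_class.
Proof. by move=> a v; rewrite -quotv_scale_class. Qed.

HB.instance Definition _ :=
  GRing.isScalable.Build k V quotv *:%R quotv_class quotv_class_is_scalable.

(* The map induced on the quotient by [f]; meaningful when [f] kills [X]. *)
Definition quotv_lift (W : lmodType k) (f : V -> W) (q : quotv) : W :=
  f (repr (q : zquot)).

Lemma quotv_lift_class (W : lmodType k) (f : {linear V -> W}) v :
  (forall x, X x -> f x = 0) -> quotv_lift f (quotv_class v) = f v.
Proof.
move=> fX; apply/eqP; rewrite -subr_eq0 /quotv_lift -raddfB; apply/eqP.
have /asboolP[n [c [x [Xx ->]]]] :
  repr (quotv_class v : zquot) - v \in linear_span.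
  by rewrite -quotv_class_eq /quotv_class reprK.
rewrite raddf_sum big1 // => i _ /=.
by rewrite linearZ_LR fX // scaler0.
Qed.

End Span.

Arguments quotv_class {k V} X v.

Section Cocenter.
Variables (k : fieldType) (C : algType k).

Definition is_commutator (c : C) : Prop := exists x y : C, c = x * y - y * x.

Definition cocenter : Type := quotv is_commutator.

HB.instance Definition _ := GRing.Lmodule.on cocenter.

Definition cocenter_class : C -> cocenter := quotv_class is_commutator.

HB.instance Definition _ := GRing.Linear.on cocenter_class.

End Cocenter.

(* [P] is a coproduct of [A] and [B] in the category of unital [k]-algebras;
   an [algType k] is associative, unital and nonzero. *)
Definition is_free_product (k : fieldType) (A B P : algType k)
    (iA : {lrmorphism A -> P}) (iB : {lrmorphism B -> P}) : Prop :=
  forall (C : algType k) (f : {lrmorphism A -> C}) (g : {lrmorphism B -> C}),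
  exists h : {lrmorphism P -> C},
    ((forall a, h (iA a) = f a) /\ (forall b, h (iB b) = g b)) /\
    (forall h' : {lrmorphism P -> C},
      (forall a, h' (iA a) = f a) -> (forall b, h' (iB b) = g b) -> h' =1 h).

Definition complements_unit (k : fieldType) (A : algType k)
    (A0 : submodClosed A) : Prop :=
  (forall a : A, exists c : k, exists2 a0, a0 \in A0 & a = c%:A + a0) /\
  (forall c : k, c%:A \in A0 -> c%:A = 0 :> A).

Section Subspace.
Variables (k : fieldType) (V : lmodType k) (S : submodClosed V).

Record subspace := Subspace { subspace_val : V; _ : subspace_val \in S }.

HB.instance Definition _ := [isSub for subspace_val].
HB.instance Definition _ := [Choice of subspace by <:].
HB.instance Definition _ := [SubChoice_isSubLmodule of subspace by <:].

End Subspace.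

Section Tensor.
Variables (k : fieldType) (V W : lmodType k).

Inductive bilinear_relation : {freeg (V * W) / k} -> Prop :=
| Bilinear_l (c : k) (v v' : V) (w : W) :
    bilinear_relation (<< (c *: v + v', w) >> -
                       (c *: << (v, w) >> + << (v', w) >>))
| Bilinear_r (c : k) (v : V) (w w' : W) :
    bilinear_relation (<< (v, c *: w + w') >> -
                       (c *: << (v, w) >> + << (v, w') >>)).

Definition tensor : Type := quotv bilinear_relation.

HB.instance Definition _ := GRing.Lmodule.on tensor.

Definition tens (v : V) (w : W) : tensor :=
  quotv_class bilinear_relation << (v, w) >>.

End Tensor.

Section TensorPower.
Variables (k : fieldType) (V : lmodType k) (n : nat).

Definition set_factor (f : {ffun 'I_n -> V}) (i : 'I_n) (v : V) :
  {ffun 'I_n -> V} := [ffun j => if j == i then v else f j].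

Inductive multilinear_relation : {freeg {ffun 'I_n -> V} / k} -> Prop :=
| Multilinear (f : {ffun 'I_n -> V}) (i : 'I_n) (c : k) (v v' : V) :
    multilinear_relation
      (<< set_factor f i (c *: v + v') >> -
       (c *: << set_factor f i v >> + << set_factor f i v' >>)).

Definition tensor_power : Type := quotv multilinear_relation.

HB.instance Definition _ := GRing.Lmodule.on tensor_power.

Definition tensors (f : {ffun 'I_n -> V}) : tensor_power :=
  quotv_class multilinear_relation << f >>.

Lemma tensors_multilinear f i c v v' :
  tensors (set_factor f i (c *: v + v')) =
  c *: tensors (set_factor f i v) + tensors (set_factor f i v').
Proof.
rewrite /tensors -linearZ -raddfD; apply/eqP.
by rewrite quotv_class_eq linear_span_incl.
Qed.

(* The linear map [v_0 (x) ... (x) v_(n-1) |-> v_(s 0) (x) ... (x) v_(s (n-1))],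
   see [permute_tensors]. *)
Definition permute_factors (s : {perm 'I_n}) : tensor_power -> tensor_power :=
  quotv_lift (fglift (fun f : {ffun 'I_n -> V} => tensors [ffun j => f (s j)])).

End TensorPower.

Section FreegLift.
Variables (k : fieldType) (K : choiceType) (M : lmodType k) (f : K -> M).

Fact fglift_is_zmod_morphism : zmod_morphism (fglift f).
Proof. exact: lift_is_additive. Qed.

HB.instance Definition _ := GRing.isZmodMorphism.Build {freeg K / k} M
  (fglift f) fglift_is_zmod_morphism.

Fact fglift_is_scalable : scalable (fglift f).
Proof.
move=> c D; rewrite -[D]freeg_sumE scaler_sumr !raddf_sum /=.
apply: eq_bigr => x _; rewrite liftU scalerA.
suff -> : c *: << coeff x D *g x >> = << c * coeff x D *g x >> :> {freeg K / k}.
  by rewrite liftU.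
by apply/eqP/freeg_eqP => y; rewrite coeffZ !coeffU mulrA.
Qed.

HB.instance Definition _ := GRing.isScalable.Build k {freeg K / k} M *:%R
  (fglift f) fglift_is_scalable.

Lemma fglift1 x : fglift f << x >> = f x.
Proof. by rewrite liftU scale1r. Qed.

End FreegLift.

Section PermuteTheory.
Variables (k : fieldType) (V : lmodType k) (n : nat) (s : {perm 'I_n}).

Lemma permute_tensors_kills x : multilinear_relation x ->
  fglift (fun f : {ffun 'I_n -> V} => tensors [ffun j => f (s j)]) x = 0.
Proof.
case=> f i c v v'; rewrite raddfB raddfD /= fglift_is_scalable !fglift1.
have E w : [ffun j => set_factor f i w (s j)] =
    set_factor [ffun j => f (s j)] ((s^-1)%g i) w.
  apply/ffunP => j; rewrite !ffunE.
  by rewrite (can2_eq (permK s) (permKV s)).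
by rewrite !E tensors_multilinear subrr.
Qed.

Lemma permute_factors_class u :
  permute_factors s (quotv_class (@multilinear_relation k V n) u) =
  fglift (fun f : {ffun 'I_n -> V} => tensors [ffun j => f (s j)]) u.
Proof. exact: quotv_lift_class permute_tensors_kills. Qed.

Lemma permute_tensors (f : {ffun 'I_n -> V}) :
  permute_factors s (tensors f) = tensors [ffun j => f (s j)].
Proof. by rewrite permute_factors_class fglift1. Qed.

Fact permute_factors_is_zmod_morphism : zmod_morphism (@permute_factors k V n s).
Proof.
move=> x y; case: (quotv_classP x) => u ->; case: (quotv_classP y) => v ->.
by rewrite -raddfB !permute_factors_class fglift_is_zmod_morphism.
Qed.

HB.instance Definition _ := GRing.isZmodMorphism.Build
  (tensor_power V n) (tensor_power V n) (@permute_factors k V n s)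
  permute_factors_is_zmod_morphism.

Fact permute_factors_is_scalable : scalable (@permute_factors k V n s).
Proof.
move=> c x; case: (quotv_classP x) => u ->.
by rewrite -linearZ !permute_factors_class fglift_is_scalable.
Qed.

HB.instance Definition _ := GRing.isScalable.Build k
  (tensor_power V n) (tensor_power V n) *:%R (@permute_factors k V n s)
  permute_factors_is_scalable.

End PermuteTheory.

Section Coinvariants.
Variables (k : fieldType) (V : lmodType k) (G : Type) (act : G -> V -> V).

Definition coinvariant_relation (x : V) : Prop := exists g v, x = act g v - v.

Definition coinvariants : Type := quotv coinvariant_relation.

HB.instance Definition _ := GRing.Lmodule.on coinvariants.

Definition coinvariants_class : V -> coinvariants :=
  quotv_class coinvariant_relation.

HB.instance Definition _ := GRing.Linear.on coinvariants_class.

End Coinvariants.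

Section CyclicCoinvariants.
Variables (k : fieldType) (V : lmodType k) (n : nat).

(* The cyclic group of order [n.+1] is the additive group ['I_n.+1] of integers
   modulo [n.+1] (['Z_n.+1] would have order 2 for [n = 0]). *)
Definition rotation (g : 'I_n.+1) : {perm 'I_n.+1} := perm (addIr g).

Definition cyclic_action (g : 'I_n.+1) :
  tensor_power V n.+1 -> tensor_power V n.+1 := permute_factors (rotation g).

Lemma cyclic_actionE g (f : {ffun 'I_n.+1 -> V}) :
  cyclic_action g (tensors f) = tensors [ffun j => f (j + g)].
Proof.
rewrite /cyclic_action permute_tensors; congr tensors.
by apply/ffunP => j; rewrite !ffunE permE.
Qed.

Definition cyclic_coinvariants : Type := coinvariants cyclic_action.

HB.instance Definition _ := GRing.Lmodule.on cyclic_coinvariants.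

Definition cyclic_class : tensor_power V n.+1 -> cyclic_coinvariants :=
  coinvariants_class cyclic_action.

HB.instance Definition _ := GRing.Linear.on cyclic_class.

End CyclicCoinvariants.

Section DirectSum.
Variables (k : fieldType) (I : eqType) (V : I -> lmodType k).

Definition finite_support : pred (forall i, V i) := fun f =>
  `[< exists s : seq I, forall i, i \notin s -> f i = 0 >].

Record direct_sum := DirectSum {
  component : forall i, V i;
  _ : finite_support component }.

HB.instance Definition _ := [isSub for component].
HB.instance Definition _ := [Choice of direct_sum by <:].

Lemma direct_sum_ext (x y : direct_sum) :
  (forall i, component x i = component y i) -> x = y.
Proof. by move=> xy; apply: val_inj; apply: functional_extensionality_dep. Qed.

Fact direct_sum0_subproof : finite_support (fun i => 0).
Proof. by apply/asboolP; exists [::]. Qed.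

Fact direct_sumN_subproof (x : direct_sum) :
  finite_support (fun i => - component x i).
Proof.
case: x => f /= /asboolP[s fs]; apply/asboolP; exists s => i /fs ->.
exact: oppr0.
Qed.

Fact direct_sumD_subproof (x y : direct_sum) :
  finite_support (fun i => component x i + component y i).
Proof.
case: x y => f /= /asboolP[s fs] [g /= /asboolP[t gt]].
apply/asboolP; exists (s ++ t) => i.
by rewrite mem_cat negb_or => /andP[/fs -> /gt ->]; rewrite addr0.
Qed.

Fact direct_sumZ_subproof (a : k) (x : direct_sum) :
  finite_support (fun i => a *: component x i).
Proof.
case: x => f /= /asboolP[s fs]; apply/asboolP; exists s => i /fs ->.
exact: scaler0.
Qed.

Definition direct_sum0 := DirectSum direct_sum0_subproof.
Definition direct_sumN x := DirectSum (direct_sumN_subproof x).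
Definition direct_sumD x y := DirectSum (direct_sumD_subproof x y).
Definition direct_sumZ a x := DirectSum (direct_sumZ_subproof a x).

Fact direct_sumDA : associative direct_sumD.
Proof. by move=> x y z; apply: direct_sum_ext => i; apply: addrA. Qed.

Fact direct_sumDC : commutative direct_sumD.
Proof. by move=> x y; apply: direct_sum_ext => i; apply: addrC. Qed.

Fact direct_sumD0 : left_id direct_sum0 direct_sumD.
Proof. by move=> x; apply: direct_sum_ext => i; apply: add0r. Qed.

Fact direct_sumDN : left_inverse direct_sum0 direct_sumN direct_sumD.
Proof. by move=> x; apply: direct_sum_ext => i; apply: addNr. Qed.

HB.instance Definition _ := GRing.isZmodule.Build direct_sum
  direct_sumDA direct_sumDC direct_sumD0 direct_sumDN.

Fact direct_sumZA a b x :
  direct_sumZ a (direct_sumZ b x) = direct_sumZ (a * b) x.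
Proof. by apply: direct_sum_ext => i; apply: scalerA. Qed.

Fact direct_sumZ1 : left_id 1 direct_sumZ.
Proof. by move=> x; apply: direct_sum_ext => i; apply: scale1r. Qed.

Fact direct_sumZDr : right_distributive direct_sumZ +%R.
Proof. by move=> a x y; apply: direct_sum_ext => i; apply: scalerDr. Qed.

Fact direct_sumZDl x : {morph direct_sumZ^~ x : a b / a + b}.
Proof. by move=> a b; apply: direct_sum_ext => i; apply: scalerDl. Qed.

HB.instance Definition _ := GRing.Zmodule_isLmodule.Build k direct_sum
  direct_sumZA direct_sumZ1 direct_sumZDr direct_sumZDl.

Fact direct_sum_in_subproof i (v : V i) :
  finite_support (dfwith (fun j => 0 : V j) v).
Proof.
apply/asboolP; exists [:: i] => j; rewrite inE eq_sym => ij.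
by rewrite dfwith_out.
Qed.

Definition direct_sum_in i (v : V i) : direct_sum :=
  DirectSum (direct_sum_in_subproof v).

End DirectSum.

Arguments direct_sum_in {k I} V i v.

Section Target.
Variables (k : fieldType) (A B : algType k).

Definition unit_gluing (x : cocenter A * cocenter B) : Prop :=
  x = (cocenter_class 1, - cocenter_class 1).

Definition glued_cocenters : Type := quotv unit_gluing.

HB.instance Definition _ := GRing.Lmodule.on glued_cocenters.

Definition glued_class : cocenter A * cocenter B -> glued_cocenters :=
  quotv_class unit_gluing.

HB.instance Definition _ := GRing.Linear.on glued_class.

Variables (A0 : submodClosed A) (B0 : submodClosed B).

(* The summand of index [n] is the one for [r = n.+1]. *)
Definition cyclic_words (n : nat) : lmodType k :=
  cyclic_coinvariants (tensor (subspace A0) (subspace B0)) n.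

End Target.

Arguments cyclic_words {k A B} A0 B0 n.

(* Main.v *)
(* [A * B] is spanned by the alternating words in [A0] and [B0].  Modulo
   commutators an odd word [a w a'] equals [(a' a) w], that is, a shorter odd
   word plus an even one; so the cocenter is generated by [A], [B] and the even
   words, and the latter only matter up to cyclic rotation.  The content is
   that no further relations arise, i.e. that these reduction rules define a
   trace on [A * B] with values in the target.  As in van der Waerden's proof of
   the normal form theorem, [A] and [B] act on the space of multilinear forms on
   alternating words by [(phi . a) w = phi (a w)]; by the universal property so
   does [A * B], and a form [phi] extends to the linear map
   [p |-> (phi . p) 1] on [A * B].  This map is a trace as soon as [phi] is
   compatible with the rotation and reduction of words, and the inverse of the
   induced map on the cocenter comes from the universal properties of the
   summands of the target. *)

From HB Require Import structures.
Require Import Defs.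
From mathcomp Require Import all_boot all_fingroup all_algebra.
From mathcomp Require Import boolp functions.
From mathcomp Require Import freeg.
From mathcomp Require Import zify.

Set Implicit Arguments.
Unset Strict Implicit.
Unset Printing Implicit Defensive.

Import GRing.Theory.
Local Open Scope ring_scope.

(** * Endomorphisms acting on the right *)

Section RightEndomorphisms.
Variables (k : fieldType) (L : lmodType k).

Definition endo_pred (f : L -> L) : bool := `[< linear f >].

Lemma endo_pred_submod : submod_closed endo_pred.
Proof.
split; first by apply/asboolP => c x y; rewrite /= scaler0 addr0.
move=> a f g /asboolP f_lin /asboolP g_lin; apply/asboolP => c x y /=.
rewrite !fctE f_lin g_lin !scalerDr !scalerA (mulrC a) -!addrA; congr (_ + _).
by rewrite addrCA.
Qed.

HB.instance Definition _ :=
  GRing.isSubmodClosed.Build k (L -> L) endo_pred endo_pred_submod.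

Variables (l : L) (l_neq0 : l != 0).

Local Notation S := (GRing.SubmodClosed.clone k (L -> L) endo_pred _).

(* The argument makes the ring nontrivial, as an [algType] has to be. *)
Definition right_endo of l != 0 : Type := subspace S.

Local Notation E := (right_endo l_neq0).

HB.instance Definition _ := GRing.Lmodule.on E.

Definition endo_app (f : E) : L -> L := val f.

Fact endo_app_linear (f : E) : linear (endo_app f).
Proof. by apply/asboolP; apply: (valP f). Qed.

HB.instance Definition _ (f : E) :=
  GRing.isLinear.Build k L L *:%R (endo_app f) (endo_app_linear f).

Lemma endo_ext (f g : E) : endo_app f =1 endo_app g -> f = g.
Proof. by move=> fg; apply/val_inj/funext. Qed.

Lemma endo_appP a (f g : E) x :
  endo_app (a *: f + g) x = a *: endo_app f x + endo_app g x.
Proof. by []. Qed.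

Definition mk_endo (f : L -> L) (f_lin : linear f) : E :=
  @Subspace k (L -> L) S f (asboolT f_lin : f \in S).

Fact endo1_subproof : linear (@id L). Proof. by []. Qed.

Fact endoM_subproof (f g : E) : linear (endo_app g \o endo_app f).
Proof. by move=> c x y; rewrite /= !linearP. Qed.

Definition endo1 := mk_endo endo1_subproof.
(** The left factor is applied first, so that the right action of the factors on forms becomes an
    algebra morphism into this ring. *)
Definition endoM f g := mk_endo (endoM_subproof f g).

Fact endoMA : associative endoM.
Proof. by move=> f g h; apply: endo_ext. Qed.

Fact endo1M : left_id endo1 endoM.
Proof. by move=> f; apply: endo_ext. Qed.

Fact endoM1 : right_id endo1 endoM.
Proof. by move=> f; apply: endo_ext. Qed.

Fact endoMDl : left_distributive endoM +%R.
Proof. by move=> f g h; apply: endo_ext => x; apply: (raddfD (endo_app h)). Qed.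

Fact endoMDr : right_distributive endoM +%R.
Proof. by move=> f g h; apply: endo_ext. Qed.

Fact endo1_neq0 : endo1 != 0.
Proof.
apply/eqP => /(congr1 (fun f => endo_app f l)) l0.
by move: l_neq0; rewrite -[l]/(endo_app endo1 l) l0 eqxx.
Qed.

HB.instance Definition _ := GRing.Zmodule_isNzRing.Build E
  endoMA endo1M endoM1 endoMDl endoMDr endo1_neq0.

Fact endo_scaleAl c (f g : E) : c *: (f * g) = (c *: f) * g.
Proof. by apply: endo_ext => x; apply/esym/(linearZ_LR (endo_app g)). Qed.

HB.instance Definition _ := GRing.Lmodule_isLalgebra.Build k E endo_scaleAl.

Fact endo_scaleAr c (f g : E) : c *: (f * g) = f * (c *: g).
Proof. by apply: endo_ext. Qed.

HB.instance Definition _ := GRing.Lalgebra_isAlgebra.Build k E endo_scaleAr.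

Lemma endo_app1 x : endo_app (1 : E) x = x. Proof. by []. Qed.

Lemma endo_appM (f g : E) x : endo_app (f * g) x = endo_app g (endo_app f x).
Proof. by []. Qed.

End RightEndomorphisms.

(** * Linear maps out of quotients, tensors and direct sums *)

Section LinearMapsOut.
Variable k : fieldType.

Lemma linear_fun0 (V W : lmodType k) (f : V -> W) : linear f -> f 0 = 0.
Proof.
by move=> f_lin; have := f_lin (-1) 0 0; rewrite scaler0 addr0 scaleN1r addNr.
Qed.

Lemma pair0_linear (U W : lmodType k) : linear (fun x : U => (x, 0) : U * W).
Proof.
move=> c x y; rewrite -[RHS]/(c *: x + y, c *: (0 : W) + 0).
by rewrite scaler0 addr0.
Qed.

Lemma pair0r_linear (U W : lmodType k) : linear (fun x : W => (0, x) : U * W).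
Proof.
move=> c x y; rewrite -[RHS]/(c *: (0 : U) + 0, c *: x + y).
by rewrite scaler0 addr0.
Qed.

(** [quotv_lift] evaluates [f] at a chosen representative; the choice is immaterial because [f]
    kills the relations, and linearity follows. *)
Lemma quotv_desc (V W : lmodType k) (X : V -> Prop) (f : V -> W) :
  linear f -> (forall x, X x -> f x = 0) ->
  exists g : {linear quotv X -> W}, forall v, g (quotv_class X v) = f v.
Proof.
move=> f_lin fX; pose F := HB.pack_for {linear V -> W} f
  (GRing.isLinear.Build k V W *:%R f f_lin).
have gE v : quotv_lift f (quotv_class X v) = f v.
  exact: (@quotv_lift_class _ _ _ _ F).
have g_lin : linear (quotv_lift f : quotv X -> W).
  move=> c p q; case: (quotv_classP p) => u ->; case: (quotv_classP q) => v ->.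
  by rewrite -linearP !gE f_lin.
pose g := HB.pack_for {linear quotv X -> W} (quotv_lift f)
  (GRing.isLinear.Build k (quotv X) W *:%R (quotv_lift f) g_lin).
by exists g.
Qed.

(** The membership predicates of subspaces: such a property need only be checked on generators. *)
Definition linear_property (V : lmodType k) (Q : V -> Prop) :=
  Q 0 /\ forall c x y, Q x -> Q y -> Q (c *: x + y).

Lemma linear_property_eq (U W : lmodType k) (f g : U -> W) :
  linear f -> linear g -> linear_property (fun x => f x = g x).
Proof.
move=> f_lin g_lin; split=> [|c x y fgx fgy]; first by rewrite !linear_fun0.
by rewrite f_lin g_lin fgx fgy.
Qed.

Lemma linear_property_comp (U W : lmodType k) (f : U -> W) (Q : W -> Prop) :
  linear f -> linear_property Q -> linear_property (fun x => Q (f x)).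
Proof.
move=> f_lin [Q0 Q_lin]; split=> [|c x y Qx Qy]; first by rewrite linear_fun0.
by rewrite f_lin; apply: Q_lin.
Qed.

Lemma linear_property_sum (V : lmodType k) (Q : V -> Prop) (I : Type)
    (s : seq I) (c : I -> k) (x : I -> V) :
  linear_property Q -> (forall i, Q (x i)) -> Q (\sum_(i <- s) c i *: x i).
Proof.
by move=> [Q0 Q_lin] Qx; elim/big_rec: _ => // i y _ Qy; apply: Q_lin.
Qed.

Lemma freeg_ind (K : choiceType) (Q : {freeg K / k} -> Prop) :
  linear_property Q -> (forall x, Q << x >>) -> forall D, Q D.
Proof.
move=> Q_lin Qx D; rewrite -[D]freeg_sumE.
rewrite (eq_bigr (fun x => coeff x D *: << x >>)) => [|x _].
  exact: linear_property_sum.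
by apply/eqP/freeg_eqP => y; rewrite coeffZ !coeffU mul1r.
Qed.

Lemma quotv_ind (V : lmodType k) (X : V -> Prop) (Q : quotv X -> Prop) :
  (forall v, Q (quotv_class X v)) -> forall q, Q q.
Proof. by move=> QV q; case: (quotv_classP q) => v ->. Qed.

Lemma cocenter_classC (P : algType k) (p q : P) :
  cocenter_class (p * q) = cocenter_class (q * p).
Proof.
apply/eqP; rewrite /cocenter_class quotv_class_eq.
by apply: linear_span_incl; exists p, q.
Qed.

Section Tensors.
Variables V W : lmodType k.

Lemma tens_linl c (v v' : V) (w : W) :
  tens (c *: v + v') w = c *: tens v w + tens v' w.
Proof.
rewrite /tens -linearZ -raddfD; apply/eqP; rewrite quotv_class_eq.
by apply: linear_span_incl; apply: Bilinear_l.
Qed.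

Lemma tens_linr c (v : V) (w w' : W) :
  tens v (c *: w + w') = c *: tens v w + tens v w'.
Proof.
rewrite /tens -linearZ -raddfD; apply/eqP; rewrite quotv_class_eq.
by apply: linear_span_incl; apply: Bilinear_r.
Qed.

Lemma tens0l (w : W) : tens (0 : V) w = 0.
Proof.
apply: (@linear_fun0 V (tensor V W) (fun v => tens v w)) => c v v'.
exact: tens_linl.
Qed.

Lemma tensor_desc (U : lmodType k) (m : V -> W -> U) :
  (forall w, linear (m^~ w)) -> (forall v, linear (m v)) ->
  exists g : {linear tensor V W -> U}, forall v w, g (tens v w) = m v w.
Proof.
move=> ml mr; pose F := fglift (fun p : V * W => m p.1 p.2).
have [|x [c v v' w|c v w w']|g gE] :=
  @quotv_desc _ _ (@bilinear_relation k V W) F.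
- exact: linearP.
- by rewrite /F raddfB raddfD /= fglift_is_scalable !fglift1 /= ml subrr.
- by rewrite /F raddfB raddfD /= fglift_is_scalable !fglift1 /= mr subrr.
by exists g => v w; rewrite gE /F fglift1.
Qed.

Lemma tensor_ind (Q : tensor V W -> Prop) :
  linear_property Q -> (forall v w, Q (tens v w)) -> forall t, Q t.
Proof.
move=> [Q0 Q_lin] Qt; apply: quotv_ind; apply: freeg_ind => [|[v w]].
  split=> [|c x y Qx Qy]; first by rewrite raddf0.
  by rewrite linearP; apply: Q_lin.
exact: Qt.
Qed.

End Tensors.

Section TensorPowers.
Variables (V : lmodType k) (n : nat).

Definition multilinear_map (U : lmodType k) (F : {ffun 'I_n -> V} -> U) :=
  forall f i c v v', F (set_factor f i (c *: v + v')) =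
    c *: F (set_factor f i v) + F (set_factor f i v').

Lemma tensor_power_desc (U : lmodType k) (F : {ffun 'I_n -> V} -> U) :
  multilinear_map F ->
  exists g : {linear tensor_power V n -> U}, forall f, g (tensors f) = F f.
Proof.
move=> F_lin.
have [|x [f i c v v']|g gE] :=
  @quotv_desc _ _ (@multilinear_relation k V n) (fglift F).
- exact: linearP.
- by rewrite raddfB raddfD /= fglift_is_scalable !fglift1 F_lin subrr.
by exists g => f; rewrite gE fglift1.
Qed.

Lemma tensor_power_ind (Q : tensor_power V n -> Prop) :
  linear_property Q -> (forall f, Q (tensors f)) -> forall t, Q t.
Proof.
move=> [Q0 Q_lin] Qt; apply: quotv_ind; apply: freeg_ind => [|f].
  split=> [|c x y Qx Qy]; first by rewrite raddf0.
  by rewrite linearP; apply: Q_lin.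
exact: Qt.
Qed.

Lemma set_factor_id (f : {ffun 'I_n -> V}) i : set_factor f i (f i) = f.
Proof. by apply/ffunP => j; rewrite ffunE; case: eqP => // ->. Qed.

Lemma tensors_eq0 (f : {ffun 'I_n -> V}) i : f i = 0 -> tensors f = 0.
Proof.
move=> fi0; rewrite -(set_factor_id f i) fi0.
apply: (@linear_fun0 _ _ (fun v => tensors (set_factor f i v))) => c v v'.
exact: tensors_multilinear.
Qed.

End TensorPowers.

(** The factors are made pure one at a time: with the others fixed, the tensor is linear in a single
    factor, where [tensor_ind] applies. *)
Lemma tensor_power_tens_ind (V W : lmodType k) n
    (Q : tensor_power (tensor V W) n -> Prop) :
  linear_property Q ->
  (forall a b, Q (tensors [ffun i => tens (a i) (b i)])) -> forall t, Q t.
Proof.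
move=> Q_lin Qt; apply: tensor_power_ind => // f.
(* Only the first [m] factors may be arbitrary; all later ones are pure. *)
suff H m : forall f : {ffun 'I_n -> tensor V W},
    (forall i : 'I_n, (m <= i)%N -> exists v w, f i = tens v w) ->
    Q (tensors f).
  by apply: (H n) => i; rewrite leqNgt ltn_ord.
elim: m => {f} [|m IHm] f f_pure.
  have {}f_pure i : exists p, f i = tens p.1 p.2.
    by have [//|v [w fi]] := f_pure i; exists (v, w).
  have [p pE] := choice f_pure.
  have -> : f = [ffun i => tens (p i).1 (p i).2].
    by apply/ffunP => i; rewrite ffunE.
  exact: (Qt (fun i => (p i).1) (fun i => (p i).2)).
have [n_le|m_lt] := leqP n m.
  by apply: IHm => i; rewrite leqNgt (leq_trans _ n_le).
pose i0 := Ordinal m_lt; rewrite -(set_factor_id f i0).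
move: (f i0); apply: tensor_ind => [|v w].
  have [Q0 Q_clos] := Q_lin; split=> [|c x y Qx Qy].
    by rewrite (@tensors_eq0 _ _ _ i0) // ffunE eqxx.
  by rewrite tensors_multilinear; apply: Q_clos.
apply: IHm => i m_le; rewrite ffunE; case: eqVneq => [_|i_neq].
  by exists v, w.
by apply: f_pure; rewrite ltn_neqAle m_le andbT eq_sym.
Qed.

Section DirectSums.
Variables (I : eqType) (V : I -> lmodType k).

Lemma component_lin c (x y : direct_sum V) i :
  component (c *: x + y) i = c *: component x i + component y i.
Proof. by []. Qed.

Lemma component_in i (v : V i) : component (direct_sum_in V i v) i = v.
Proof. exact: dfwith_in. Qed.

Lemma component_out i j (v : V i) :
  i != j -> component (direct_sum_in V i v) j = 0.
Proof. exact: dfwith_out. Qed.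

Lemma direct_sum_in_linear i : linear (direct_sum_in V i).
Proof.
move=> c u v; apply: direct_sum_ext => j; rewrite component_lin.
have [<-|ij] := eqVneq i j; first by rewrite !component_in.
by rewrite !component_out // scaler0 addr0.
Qed.

Lemma direct_sum_support (x : direct_sum V) :
  exists2 s : seq I, uniq s & forall i, i \notin s -> component x i = 0.
Proof.
case: x => f f_supp; have /asboolP[s fs] := f_supp.
by exists (undup s); rewrite ?undup_uniq // => i; rewrite mem_undup => /fs.
Qed.

Lemma direct_sum_ind (Q : direct_sum V -> Prop) :
  linear_property Q -> (forall i v, Q (direct_sum_in V i v)) -> forall x, Q x.
Proof.
move=> Q_lin Qin x; have [s s_uniq xs] := direct_sum_support x.
suff -> : x = \sum_(i <- s) 1 *: direct_sum_in V i (component x i).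
  exact: linear_property_sum.
have sumE r j : component (\sum_(i <- r) 1 *: direct_sum_in V i (component x i)) j
    = \sum_(i <- r) component (direct_sum_in V i (component x i)) j.
  elim: r => [|i r IHr]; first by rewrite !big_nil.
  by rewrite !big_cons component_lin scale1r IHr.
apply: direct_sum_ext => j; rewrite sumE.
have [js|js] := boolP (j \in s).
  rewrite (bigD1_seq j) // component_in big1 => [|i ij].
    by rewrite /= addr0.
  by rewrite component_out.
rewrite xs // big1_seq // => i /andP[_ i_s]; rewrite component_out //.
by apply: contraNneq js => <-.
Qed.

(** The map sums over a chosen list containing the support. Any duplicate-free list containing the
    support gives the same sum, so linearity is checked over one list that serves both arguments and
    their combination. *)
Lemma direct_sum_desc (U : lmodType k) (f : forall i, {linear V i -> U}) :
  exists g : {linear direct_sum V -> U},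
    forall i v, g (direct_sum_in V i v) = f i v.
Proof.
have [supp suppP] := choice (fun x => let: ex_intro2 s us xs :=
  direct_sum_support x in ex_intro (fun s => uniq s /\ _) s (conj us xs)).
pose g x := \sum_(i <- supp x) f i (component x i).
have gE x s : uniq s -> (forall i, i \notin s -> component x i = 0) ->
    g x = \sum_(i <- s) f i (component x i).
  have sum_filter r : \sum_(i <- r) f i (component x i) =
      \sum_(i <- [seq i <- r | component x i != 0]) f i (component x i).
    rewrite big_filter [RHS]big_mkcond; apply: eq_bigr => i _.
    by case: eqP => //= ->; rewrite raddf0.
  move=> s_uniq xs; have [u_uniq xu] := suppP x; rewrite /g sum_filter.
  rewrite [RHS]sum_filter; apply: perm_big; apply: uniq_perm.
  - exact: filter_uniq.
  - exact: filter_uniq.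
  move=> i; rewrite !mem_filter; case: eqP => //= xi0.
  by rewrite (contra_notT (xs i) xi0) (contra_notT (xu i) xi0).
have g_lin : linear g.
  move=> c x y; pose s := undup (supp x ++ supp y).
  have [_ xs] := suppP x; have [_ ys] := suppP y.
  have s_supp i : i \notin s -> component x i = 0 /\ component y i = 0.
    by rewrite mem_undup mem_cat negb_or => /andP[/xs -> /ys ->].
  have gs z := gE z s (undup_uniq _).
  rewrite (gs x) => [|i /s_supp[] //]; rewrite (gs y) => [|i /s_supp[] //].
  rewrite gs => [|i /s_supp[x0 y0]]; last first.
    by rewrite component_lin x0 y0 scaler0 addr0.
  rewrite scaler_sumr -big_split; apply: eq_bigr => i _.
  by rewrite component_lin linearP.
exists (HB.pack_for {linear direct_sum V -> U} g
  (GRing.isLinear.Build k (direct_sum V) U *:%R g g_lin)) => i v /=.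
rewrite (gE _ [:: i]) //; first by rewrite big_seq1 component_in.
by move=> j; rewrite inE eq_sym => ij; rewrite component_out.
Qed.

End DirectSums.

(** The components are chosen pointwise; uniqueness of the decomposition then makes them linear. *)
Lemma complement_split (A : algType k) (A0 : submodClosed A) :
  complements_unit A0 ->
  exists (eps : {scalar A}) (red : {linear A -> subspace A0}),
    [/\ forall x, x = (eps x)%:A + val (red x),
        forall u : subspace A0, eps (val u) = 0 & eps 1 = 1].
Proof.
move=> [dec indep].
have uniq_dec c c' (u u' : subspace A0) :
    c%:A + val u = c'%:A + val u' -> c = c' /\ u = u'.
  move=> cu; have cE : c%:A = c'%:A :> A.
    apply/eqP; rewrite -subr_eq0 -scalerBl; apply/eqP/indep; rewrite scalerBl.
    rewrite -(addrK (val u) c%:A) cu (addrC c'%:A) addrAC addrK -raddfB.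
    exact: valP.
  split; last first.
    by apply: val_inj; move: cu; rewrite cE => /addrI.
  (* [c%:A] determines [c] because [1] is nonzero in [A]. *)
  apply/eqP; rewrite -subr_eq0; move/eqP: cE.
  by rewrite -subr_eq0 -scalerBl scaler_eq0 oner_eq0 orbF.
have /choice[g gE] : forall x : A, exists p : k * subspace A0,
    x = p.1%:A + val p.2.
  move=> x; have [c [u Au ->]] := dec x.
  by exists (c, @Subspace k A A0 u Au).
have g_lin c x y : (g (c *: x + y)).1 = c * (g x).1 + (g y).1 /\
    (g (c *: x + y)).2 = c *: (g x).2 + (g y).2.
  apply: uniq_dec; rewrite -gE {1}(gE x) {1}(gE y) /=.
  rewrite scalerDr scalerDl scalerA -!addrA; congr (_ + _).
  by rewrite addrCA.
have eps_lin : scalar (fun x => (g x).1) by move=> c x y; case: (g_lin c x y).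
have red_lin : linear (fun x => (g x).2) by move=> c x y; case: (g_lin c x y).
exists (HB.pack_for {scalar A} (fun x => (g x).1)
  (GRing.isLinear.Build k A k *%R (fun x => (g x).1) eps_lin)).
exists (HB.pack_for {linear A -> subspace A0} (fun x => (g x).2)
  (GRing.isLinear.Build k A (subspace A0) *:%R (fun x => (g x).2) red_lin)).
split=> [x|u|] /=.
- exact: gE.
- suff [] : (g (val u)).1 = 0 /\ (g (val u)).2 = u by [].
  by apply: uniq_dec; rewrite -gE scale0r add0r.
suff [] : (g 1).1 = 1 /\ (g 1).2 = 0 by [].
by apply: uniq_dec; rewrite -gE scale1r addr0.
Qed.

End LinearMapsOut.

(** * Alternating words in a free product *)

(* The two factors are indexed by [bool].  For [x : alg s], [eps s x] and
   [red s x] are the components of [x] along [k 1] and the complement [S s]. *)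
Section FreeProductWords.
Variables (k : fieldType) (alg : bool -> algType k).
Variable (S : forall s, submodClosed (alg s)).
Variables (eps : forall s, {scalar alg s}).
Variables (red : forall s, {linear alg s -> subspace (S s)}).
Hypothesis split_unit : forall s (x : alg s), x = (eps s x)%:A + val (red s x).
Hypothesis eps_val : forall s (u : subspace (S s)), eps s (val u) = 0.
Hypothesis eps1 : forall s, eps s 1 = 1.

Lemma red_val s (u : subspace (S s)) : red s (val u) = u.
Proof.
by apply: val_inj; rewrite [RHS]split_unit eps_val scale0r add0r.
Qed.

Lemma red1 s : red s 1 = 0.
Proof.
apply: val_inj; apply: (addrI (1 : alg s)).
by rewrite -{1}(scale1r (1 : alg s)) -(eps1 s) -split_unit raddf0 addr0.
Qed.

Definition letter : Type := {s : bool & subspace (S s)}.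
HB.instance Definition _ := Choice.on letter.

Definition letter_in s (x : subspace (S s)) : letter :=
  existT (fun s => subspace (S s)) s x.

Definition alternates (w : seq letter) :=
  sorted (fun s t => s != t) [seq tag x | x <- w].

Definition avoids_head s (w : seq letter) :=
  if w is x :: _ then tag x != s else true.

Lemma alternates_cons s (x : subspace (S s)) w :
  alternates (letter_in x :: w) = avoids_head s w && alternates w.
Proof. by case: w => //= y w; rewrite /alternates /= eq_sym. Qed.

Lemma alternates_subst u s (x y : subspace (S s)) v :
  alternates (u ++ letter_in x :: v) = alternates (u ++ letter_in y :: v).
Proof. by rewrite /alternates !map_cat. Qed.

(* [head_part s w] is the leading letter of [w] if it lies in [alg s], and [1]
   otherwise; [w] represents [head_part s w * tail_part s w]. *)
Definition head_part s (w : seq letter) : alg s :=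
  if w is y :: _ then untag 1 (fun x : subspace (S s) => val x) y else 1.

Definition tail_part s (w : seq letter) : seq letter :=
  if w is y :: v then if tag y == s then v else w else [::].

Lemma head_part_cons s (x : subspace (S s)) w :
  head_part s (letter_in x :: w) = val x.
Proof. by rewrite /= (untagE _ _ (erefl : tag (letter_in x) = s)). Qed.

Lemma tail_part_cons s (x : subspace (S s)) w :
  tail_part s (letter_in x :: w) = w.
Proof. by rewrite /= eqxx. Qed.

Lemma head_part_avoids s w : avoids_head s w -> head_part s w = 1.
Proof. by case: w => //= y w ys; rewrite untag_dflt. Qed.

Lemma tail_part_avoids s w : avoids_head s w -> tail_part s w = w.
Proof. by case: w => //= y w /negPf ->. Qed.

Lemma avoids_headPn s w : ~~ avoids_head s w ->
  exists (x : subspace (S s)) v, w = letter_in x :: v.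
Proof.
by case: w => // -[t x] w /=; rewrite negbK => /eqP st; subst t; exists x, w.
Qed.

Lemma alternates_tail s w :
  alternates w -> avoids_head s (tail_part s w) && alternates (tail_part s w).
Proof.
have [h|/avoids_headPn[x [v ->]]] := boolP (avoids_head s w).
  by move=> w_alt; rewrite tail_part_avoids // h.
by rewrite alternates_cons tail_part_cons.
Qed.

(** * The space of multilinear forms and the action of the factors on it *)

Section Forms.
Variable V : lmodType k.

Definition multilinear_form (phi : seq letter -> V) :=
  forall u s c (x y : subspace (S s)) v,
    phi (u ++ letter_in (c *: x + y) :: v) =
    c *: phi (u ++ letter_in x :: v) + phi (u ++ letter_in y :: v).

(** Vanishing off the alternating words makes a form determined by its values on reduced words: it
    amounts to a family of linear maps on the alternating tensor products of the complements. *)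
Definition form_pred (phi : seq letter -> V) : bool :=
  `[< multilinear_form phi /\ forall w, ~~ alternates w -> phi w = 0 >].

Lemma form_pred_submod : submod_closed form_pred.
Proof.
split.
  by apply/asboolP; split=> // u s c x y v; rewrite /= scaler0 addr0.
move=> a f g /asboolP[f_lin f0] /asboolP[g_lin g0]; apply/asboolP; split.
  move=> u s c x y v; rewrite !fctE f_lin g_lin !scalerDr !scalerA (mulrC a).
  by rewrite -!addrA; congr (_ + _); rewrite addrCA.
by move=> w w_alt; rewrite !fctE f0 // g0 // scaler0 addr0.
Qed.

HB.instance Definition _ :=
  GRing.isSubmodClosed.Build k (seq letter -> V) form_pred form_pred_submod.

Local Notation FS := (GRing.SubmodClosed.clone k (seq letter -> V) form_pred _).

Definition form : Type := subspace FS.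
HB.instance Definition _ := GRing.Lmodule.on form.

Definition form_app (phi : form) : seq letter -> V := val phi.

Lemma form_app_lin c (f g : form) w :
  form_app (c *: f + g) w = c *: form_app f w + form_app g w.
Proof. by []. Qed.

Lemma form_ext (f g : form) : form_app f =1 form_app g -> f = g.
Proof. by move=> fg; apply/val_inj/funext. Qed.

Lemma form_lin (phi : form) : multilinear_form (form_app phi).
Proof. by have /asboolP[] := valP phi. Qed.

Lemma form_alt (phi : form) w : ~~ alternates w -> form_app phi w = 0.
Proof. by have /asboolP[_] := valP phi; apply. Qed.

Definition mk_form f (f_lin : multilinear_form f)
    (f_alt : forall w, ~~ alternates w -> f w = 0) : form :=
  @Subspace k (seq letter -> V) FS f (asboolT (conj f_lin f_alt) : f \in FS).

(* The value of [phi] on the possibly non-reduced word [x w], when [w] does not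
   start in [alg s]. *)
Definition prepend (phi : seq letter -> V) s (x : alg s) w : V :=
  eps s x *: phi w + phi (letter_in (red s x) :: w).

Lemma prepend_lin phi s c (x y : alg s) w : multilinear_form phi ->
  prepend phi (c *: x + y) w = c *: prepend phi x w + prepend phi y w.
Proof.
move=> phi_lin; rewrite /prepend (linearP (eps s)) (linearP (red s)).
rewrite (phi_lin [::]) /=.
rewrite scalerDl scalerDr scalerA -!addrA; congr (_ + _).
by rewrite addrCA.
Qed.

Lemma prepend_val phi s (u : subspace (S s)) w :
  prepend phi (val u) w = phi (letter_in u :: w).
Proof. by rewrite /prepend eps_val red_val scale0r add0r. Qed.

Lemma form0 phi s u v : multilinear_form phi ->
  phi (u ++ letter_in (0 : subspace (S s)) :: v) = 0.
Proof.
move=> phi_lin; have := phi_lin u s (-1) 0 0 v.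
by rewrite scaler0 addr0 scaleN1r addNr.
Qed.

Lemma prepend1 phi s w :
  multilinear_form phi -> prepend phi (1 : alg s) w = phi w.
Proof.
by move=> phi_lin; rewrite /prepend eps1 red1 scale1r (form0 s [::]) // addr0.
Qed.

Lemma prepend_multilinear phi s (a : alg s) :
  multilinear_form phi -> multilinear_form (prepend phi a).
Proof.
move=> phi_lin u t c x y v; rewrite /prepend phi_lin -!cat_cons phi_lin.
rewrite !scalerDr !scalerA (mulrC c) -!addrA; congr (_ + _).
by rewrite addrCA.
Qed.

(** A leading letter of [alg s] is first absorbed into [a]; the product is then split along [k 1]
    and the complement, so that [phi] is only evaluated on reduced words. The value [0] off the
    alternating words keeps the result a form. *)
Definition act_fun s (a : alg s) (phi : seq letter -> V) (w : seq letter) : V :=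
  if alternates w then prepend phi (a * head_part s w) (tail_part s w) else 0.

(** The varied letter is either the one absorbed by [a], where linearity of [prepend] in its algebra
    argument applies, or it stays in the tail, where [prepend] is multilinear. *)
Lemma act_multilinear s (a : alg s) (phi : form) :
  multilinear_form (act_fun a (form_app phi)).
Proof.
move=> u t c x y v; rewrite /act_fun.
rewrite -(alternates_subst u x) (alternates_subst u y x).
case: ifP => _; last by rewrite scaler0 addr0.
have phi_lin := form_lin phi.
case: u => [|z u].
  have [ts|ts] := eqVneq t s.
    subst t; rewrite !head_part_cons !tail_part_cons.
    by rewrite linearP /= mulrDr -scalerAr prepend_lin.
  rewrite !head_part_avoids ?tail_part_avoids //.
  exact: (prepend_multilinear _ phi_lin [::]).
rewrite /=; case: ifP => _; first exact: prepend_multilinear.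
exact: (prepend_multilinear _ phi_lin (z :: u)).
Qed.

Fact act_alt s (a : alg s) (phi : form) w :
  ~~ alternates w -> act_fun a (form_app phi) w = 0.
Proof. by rewrite /act_fun => /negPf ->. Qed.

Definition act s (a : alg s) (phi : form) : form :=
  mk_form (act_multilinear a phi) (act_alt a phi).

Lemma actE s (a : alg s) phi w : alternates w ->
  form_app (act a phi) w =
  prepend (form_app phi) (a * head_part s w) (tail_part s w).
Proof.
by move=> w_alt; rewrite -[LHS]/(act_fun a (form_app phi) w) /act_fun w_alt.
Qed.

Lemma act_avoids s (a : alg s) phi w : alternates w -> avoids_head s w ->
  form_app (act a phi) w = prepend (form_app phi) a w.
Proof.
move=> w_alt ws.
by rewrite actE // head_part_avoids // tail_part_avoids // mulr1.
Qed.

Lemma form_extP (f g : form) :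
  (forall w, alternates w -> form_app f w = form_app g w) -> f = g.
Proof.
move=> fg; apply: form_ext => w; have [/fg //|w_alt] := boolP (alternates w).
by rewrite !form_alt.
Qed.

Lemma act_linear s (a : alg s) : linear (act a).
Proof.
move=> c f g; apply: form_extP => w w_alt.
rewrite form_app_lin !actE // /prepend !form_app_lin !scalerDr !scalerA.
by rewrite (mulrC c) -!addrA; congr (_ + _); rewrite addrCA.
Qed.

Lemma act_linearl s c (a b : alg s) phi :
  act (c *: a + b) phi = c *: act a phi + act b phi.
Proof.
apply: form_extP => w w_alt; rewrite form_app_lin !actE //.
by rewrite mulrDl -scalerAl prepend_lin //; apply: form_lin.
Qed.

Lemma act1 s phi : act (1 : alg s) phi = phi.
Proof.
apply: form_extP => w w_alt; rewrite actE // mul1r.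
have [ws|/avoids_headPn[x [v ->]]] := boolP (avoids_head s w).
  rewrite head_part_avoids // tail_part_avoids // prepend1 //; exact: form_lin.
by rewrite head_part_cons tail_part_cons prepend_val.
Qed.

(** Put [x = b * head_part s w]. Acting by [b] splits [x] into a scalar and a letter; acting by [a]
    on the two resulting words gives [prepend] at [a], weighted by [eps s x], and at
    [a * val (red s x)]. By linearity these recombine to [prepend] at [a * x]. *)
Lemma actM s (a b : alg s) phi : act (a * b) phi = act b (act a phi).
Proof.
apply: form_extP => w w_alt; rewrite !actE //.
have /andP[] := alternates_tail s w_alt.
set v := tail_part s w; set x := b * _ => vs v_alt.
have -> : a * b * head_part s w = a * x by rewrite mulrA.
rewrite {2}/prepend act_avoids // actE ?alternates_cons ?vs //.
rewrite head_part_cons tail_part_cons -prepend_lin; last exact: form_lin.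
by congr prepend; rewrite {1}(split_unit x) mulrDr -scalerAr mulr1.
Qed.

End Forms.

(** * Reduced words span the free product *)

Section Evaluation.
Variables (P : algType k) (iota : forall s, {lrmorphism alg s -> P}).

Definition is_coproduct := forall (C : algType k)
    (f : forall s, {lrmorphism alg s -> C}),
  exists h : {lrmorphism P -> C}, (forall s x, h (iota s x) = f s x) /\
    forall h' : {lrmorphism P -> C},
      (forall s x, h' (iota s x) = f s x) -> h' =1 h.

Hypothesis freeP : is_coproduct.

Definition word_prod (w : seq letter) : P :=
  \prod_(x <- w) iota (tag x) (val (tagged x)).

Lemma word_prod_nil : word_prod [::] = 1.
Proof. exact: big_nil. Qed.

Lemma word_prod_cons s (x : subspace (S s)) w :
  word_prod (letter_in x :: w) = iota s (val x) * word_prod w.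
Proof. exact: big_cons. Qed.

Lemma word_prod_cat u v : word_prod (u ++ v) = word_prod u * word_prod v.
Proof. exact: big_cat. Qed.

Lemma word_prod_head s w :
  word_prod w = iota s (head_part s w) * word_prod (tail_part s w).
Proof.
have [ws|/avoids_headPn[x [v ->]]] := boolP (avoids_head s w).
  by rewrite head_part_avoids // tail_part_avoids // rmorph1 mul1r.
by rewrite word_prod_cons head_part_cons tail_part_cons.
Qed.

Lemma iota_split s (x : alg s) :
  iota s x = eps s x *: 1 + iota s (val (red s x)).
Proof. by rewrite {1}(split_unit x) linearP rmorph1. Qed.

Lemma iota_mulA s (x y : alg s) p :
  iota s x * (iota s y * p) = iota s (x * y) * p.
Proof. by rewrite rmorphM mulrA. Qed.

Section Span.

Definition reduced_word (p : P) : Prop :=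
  exists2 w, alternates w & p = word_prod w.

Local Notation R := (linear_span reduced_word).

Lemma reduced_span_ind (Q : P -> Prop) :
  (forall c p q, Q p -> Q q -> Q (c *: p + q)) -> Q 0 ->
  (forall w, alternates w -> Q (word_prod w)) -> forall p, p \in R -> Q p.
Proof.
move=> Q_lin Q0 Qw p /asboolP[n [c [x [Xx ->]]]].
elim/big_rec: _ => // i q _ Qq; apply: Q_lin => //.
by have [w w_alt ->] := Xx i; apply: Qw.
Qed.

(** Merging [x] with the head of a reduced word and splitting the result along [k 1] leaves a
    combination of two reduced words. *)
Lemma reduced_span_letter s (x : alg s) p : p \in R -> iota s x * p \in R.
Proof.
move: p; apply: reduced_span_ind => [c p q Rp Rq||w w_alt].
- by rewrite mulrDr -scalerAr rpredD // rpredZ.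
- by rewrite mulr0 rpred0.
rewrite (word_prod_head s) iota_mulA.
have /andP[] := alternates_tail s w_alt.
move: (x * _) (tail_part s w) => y v vs v_alt.
rewrite iota_split mulrDl -scalerAl mul1r -word_prod_cons.
apply: rpredD; first by apply: rpredZ; apply: linear_span_incl; exists v.
apply: linear_span_incl; exists (letter_in (red s y) :: v) => //.
by rewrite alternates_cons vs.
Qed.

Fact reduced_span_subalg : GRing.subsemialg_closed R.
Proof.
split; first by rewrite -word_prod_nil linear_span_incl //; exists [::].
- by split; [exact: rpred0|exact: rpredD].
- by move=> a u; exact: rpredZ.
move=> p q Rp Rq; move: p Rp; apply: reduced_span_ind => [c p p' Rp Rp'||w _].
- by rewrite mulrDl -scalerAl rpredD // rpredZ.
- by rewrite mul0r rpred0.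
(* The letters of the left-hand word are multiplied onto [q] one at a time. *)
elim: w => [|[s x] w IHw]; first by rewrite word_prod_nil mul1r.
by rewrite (@word_prod_cons s x w) -mulrA reduced_span_letter.
Qed.

Record span_alg := SpanAlg { span_val : P; _ : span_val \in R }.

HB.instance Definition _ := [isSub for span_val].
HB.instance Definition _ := [Choice of span_alg by <:].
HB.instance Definition _ :=
  GRing.SubChoice_isSubAlgebra.Build k P R span_alg reduced_span_subalg.

Definition span_incl (x : span_alg) : P := val x.

Fact span_incl_linear : linear span_incl. Proof. by []. Qed.
Fact span_incl_monoid : monoid_morphism span_incl. Proof. by []. Qed.

HB.instance Definition _ := GRing.isLinear.Build k span_alg P *:%R
  span_incl span_incl_linear.
HB.instance Definition _ := GRing.isMonoidMorphism.Build span_alg P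
  span_incl span_incl_monoid.

Lemma iota_span s x : iota s x \in R.
Proof.
rewrite -[iota s x]mulr1; apply: reduced_span_letter.
by have [] := reduced_span_subalg.
Qed.

Definition iota_corestr s (x : alg s) : span_alg := SpanAlg (iota_span x).

Fact iota_corestr_linear s : linear (@iota_corestr s).
Proof. by move=> c x y; apply: val_inj; rewrite /= linearP. Qed.

Fact iota_corestr_monoid s : monoid_morphism (@iota_corestr s).
Proof.
by split=> [|x y]; apply: val_inj; rewrite /= ?rmorph1 ?rmorphM.
Qed.

HB.instance Definition _ s := GRing.isLinear.Build k (alg s) span_alg *:%R
  (@iota_corestr s) (@iota_corestr_linear s).
HB.instance Definition _ s := GRing.isMonoidMorphism.Build (alg s) span_alg
  (@iota_corestr s) (@iota_corestr_monoid s).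

(* The retraction of [P] onto the span, composed with the inclusion, must be
   the identity by the uniqueness clause. *)
Lemma reduced_words_span p : p \in R.
Proof.
have [h [h_iota _]] := freeP (fun s => @iota_corestr s : {lrmorphism _ -> _}).
have [g [_ g_uniq]] := freeP iota.
have -> : p = val (h p).
  rewrite -[LHS]/(idfun p) (g_uniq idfun) // -(g_uniq (span_incl \o h)) //=.
  by move=> s x; rewrite h_iota.
exact: valP.
Qed.

End Span.

Lemma word_ind (Q : P -> Prop) :
  (forall c p q, Q p -> Q q -> Q (c *: p + q)) ->
  (forall w, alternates w -> Q (word_prod w)) -> forall p, Q p.
Proof.
move=> Q_lin Qw p; apply: reduced_span_ind (reduced_words_span p) => //.
have Q1 := Qw [::] isT; have := Q_lin (-1) _ _ Q1 Q1.
by rewrite scaleN1r addNr.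
Qed.

(** * Evaluating forms on the free product *)

Section FormEvaluation.
Variable V : lmodType k.

(** [T phi p] is the value of [phi . p] at the empty word; the trace argument relies on these three
    properties alone. *)
Definition form_evaluation (T : form V -> P -> V) :=
  [/\ forall phi, linear (T phi),
      forall phi s (x : alg s) p, T phi (iota s x * p) = T (act x phi) p
    & forall phi, T phi 1 = form_app phi [::]].

Section Nontrivial.
Variables (v : V) (v_neq0 : v != 0).

(** A form supported on the empty word: it shows that the space of forms is nonzero, so that its
    endomorphisms make up an [algType] to which the universal property applies. *)
Definition vacuum_fun (w : seq letter) : V := if w is [::] then v else 0.

Fact vacuum_lin : multilinear_form vacuum_fun.
Proof. by case=> [|y u] s c x x' w; rewrite /= scaler0 addr0. Qed.

Fact vacuum_alt w : ~~ alternates w -> vacuum_fun w = 0.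
Proof. by case: w. Qed.

Definition vacuum := mk_form vacuum_lin vacuum_alt.

Fact vacuum_neq0 : vacuum != 0.
Proof.
apply: contra_neq v_neq0 => /(congr1 (fun f => form_app f [::])).
by [].
Qed.

Definition act_endo s (x : alg s) : right_endo vacuum_neq0 :=
  mk_endo vacuum_neq0 (@act_linear V s x).

Fact act_endo_linear s : linear (@act_endo s).
Proof. by move=> c x y; apply: endo_ext => phi; apply: act_linearl. Qed.

Fact act_endo_monoid s : monoid_morphism (@act_endo s).
Proof.
split=> [|x y]; apply: endo_ext => phi; first exact: act1.
exact: actM.
Qed.

HB.instance Definition _ s := GRing.isLinear.Build k (alg s)
  (right_endo vacuum_neq0) *:%R (@act_endo s) (@act_endo_linear s).
HB.instance Definition _ s := GRing.isMonoidMorphism.Build (alg s)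
  (right_endo vacuum_neq0) (@act_endo s) (@act_endo_monoid s).

(** By the universal property, the actions of the two factors extend to an action of [P] on the
    forms. *)
Lemma form_evaluation_nontrivial : exists T, form_evaluation T.
Proof.
have [h [h_iota _]] := freeP (fun s => @act_endo s : {lrmorphism _ -> _}).
exists (fun phi p => form_app (endo_app (h p) phi) [::]); split.
- by move=> phi c p q; rewrite (linearP h) endo_appP form_app_lin.
- move=> phi s x p.
  have -> : h (iota s x * p) = h (iota s x) * h p := rmorphM h _ _.
  by rewrite h_iota endo_appM.
by move=> phi; rewrite (rmorph1 h) endo_app1.
Qed.

End Nontrivial.
End FormEvaluation.

(* [V] may be zero, and then so is its space of forms; forms are therefore
   evaluated after enlarging [V] to [V * k]. *)
Section FormEvaluationExists.
Variable V : lmodType k.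

Fact form_pair_lin (phi : form V) :
  multilinear_form (fun w => (form_app phi w, 0) : V * k^o).
Proof.
move=> u s c x y v; rewrite form_lin.
exact: pair0_linear.
Qed.

Fact form_pair_alt (phi : form V) w :
  ~~ alternates w -> ((form_app phi w, 0) : V * k^o) = 0.
Proof. by move=> w_alt; rewrite form_alt. Qed.

Definition form_pair (phi : form V) : form (V * k^o)%type :=
  mk_form (form_pair_lin phi) (@form_pair_alt phi).

Lemma act_pair s (x : alg s) phi :
  act x (form_pair phi) = form_pair (act x phi).
Proof.
apply: form_extP => w w_alt; rewrite actE //.
rewrite -[RHS]/(form_app (act x phi) w, 0) actE //.
exact/esym/pair0_linear.
Qed.

Lemma form_evaluation_exists : exists T, @form_evaluation V T.
Proof.
have [|T [T_lin T_act T1]] := @form_evaluation_nontrivial (V * k^o)%type (0, 1).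
  by apply/eqP => -[/eqP]; rewrite oner_eq0.
exists (fun phi p => (T (form_pair phi) p).1); split.
- by move=> phi c p q; rewrite T_lin.
- by move=> phi s x p; rewrite T_act act_pair.
- by move=> phi; rewrite T1.
Qed.

End FormEvaluationExists.

(** * Words seen from both ends *)

Lemma alternates_rev w : alternates (rev w) = alternates w.
Proof.
rewrite /alternates map_rev rev_sorted.
by apply: eq_sorted => s t; rewrite eq_sym.
Qed.

Lemma alternates_rcons s (x : subspace (S s)) w :
  alternates (rcons w (letter_in x)) = avoids_head s (rev w) && alternates w.
Proof. by rewrite -alternates_rev rev_rcons alternates_cons alternates_rev. Qed.

Lemma word_prod_rcons s (x : subspace (S s)) w :
  word_prod (rcons w (letter_in x)) = word_prod w * iota s (val x).
Proof. by rewrite -cats1 word_prod_cat word_prod_cons word_prod_nil mulr1. Qed.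

(** The words that can be flanked on both sides by letters of [S s] and stay alternating; the empty
    word would put two such letters side by side. *)
Definition inner s w :=
  [&& w != [::], alternates w, avoids_head s w & avoids_head s (rev w)].

(** Letters of [alg s] are split off at both ends, with [1] where there is none. If the word is a
    single letter of [alg s], it is counted on the left and the middle is empty. *)
Lemma word_prod_sandwich s w : alternates w -> exists l r v,
  word_prod w = iota s l * word_prod v * iota s r /\ (v = [::] \/ inner s v).
Proof.
move=> w_alt; rewrite (word_prod_head s).
have /andP[] := alternates_tail s w_alt.
move: (head_part s w) (tail_part s w) => l u us u_alt.
have [->|u_neq0] := eqVneq u [::].
  by exists l, 1, [::]; rewrite rmorph1 mulr1; split=> //; left.
have [h|/avoids_headPn[x [v uE]]] := boolP (avoids_head s (rev u)).
  exists l, 1, u; rewrite rmorph1 mulr1; split=> //; right.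
  by rewrite /inner u_neq0 u_alt us.
have {}uE : u = rcons (rev v) (letter_in x) by rewrite -rev_cons -uE revK.
move: (rev v) uE => {}v uE; exists l, (val x), v.
rewrite uE word_prod_rcons mulrA; split=> //.
have [->|v_neq0] := eqVneq v [::]; [by left|right].
move: us u_alt; rewrite uE alternates_rcons /inner v_neq0 => us /andP[-> ->].
by rewrite andbT; case: (v) v_neq0 us.
Qed.

(** * Traces on a free product *)

Section TraceCriterion.
Variables (V : lmodType k) (phi : form V).

(** Invariance under moving a letter of [alg s] from the end of a word to its front, in three cases:
    the whole word lies in [alg s], the rest of the word is flanked by the other algebra, or the
    moved letter meets another letter of [alg s] and merges with it. *)
Definition cyclic_form :=
  [/\ forall s (x y : alg s),
        prepend (form_app phi) (x * y) [::] =
        prepend (form_app phi) (y * x) [::],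
      forall s (x : subspace (S s)) w, inner s w ->
        form_app phi (rcons w (letter_in x)) = form_app phi (letter_in x :: w)
    & forall s (x y : subspace (S s)) w, inner s w ->
        form_app phi (letter_in x :: rcons w (letter_in y)) =
        prepend (form_app phi) (val y * val x) w].

Variables (T : form V -> P -> V) (evalT : form_evaluation T).

(** The letters are moved one by one into the form, so [phi] varies in the induction; on a reduced
    word the action merely prepends a letter. *)
Lemma evaluation_word w : alternates w -> T phi (word_prod w) = form_app phi w.
Proof.
have [_ T_act T1] := evalT; elim: w phi => [|[s x] w IHw] f.
  by rewrite word_prod_nil T1.
rewrite (@word_prod_cons s x w) (@alternates_cons s x w) => /andP[ws w_alt].
by rewrite T_act IHw // act_avoids // prepend_val.
Qed.

Lemma evaluation_prepend s (x : alg s) w : alternates w -> avoids_head s w ->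
  T phi (iota s x * word_prod w) = prepend (form_app phi) x w.
Proof.
have [T_lin _ _] := evalT; move=> w_alt ws.
rewrite iota_split mulrDl -scalerAl mul1r T_lin -word_prod_cons.
by rewrite !evaluation_word // alternates_cons ws.
Qed.

Hypothesis phi_cyclic : cyclic_form.

(** The core of the trace property: the value depends on [l] and [r] only through [r * l]. For an
    inner [w], splitting [r] and then [l] along [k 1] leaves exactly the configurations covered by
    [cyclic_form]. *)
Lemma evaluation_sandwich s (l r : alg s) w : w = [::] \/ inner s w ->
  T phi (iota s l * word_prod w * iota s r) = prepend (form_app phi) (r * l) w.
Proof.
have [T_lin _ _] := evalT; have [phi_base phi_rot phi_odd] := phi_cyclic.
case=> [->|w_in].
  rewrite word_prod_nil mulr1 -rmorphM phi_base -evaluation_prepend //.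
  by rewrite word_prod_nil mulr1.
have /and4P[w_neq0 w_alt ws sw] := w_in.
have w'_alt (y : subspace (S s)) : alternates (rcons w (letter_in y)).
  by rewrite alternates_rcons sw.
have w's (y : subspace (S s)) : avoids_head s (rcons w (letter_in y)).
  by case: (w) w_neq0 ws.
have phi_lin := form_lin phi.
rewrite -mulrA (iota_split r) mulrDr -scalerAr mulr1 -word_prod_rcons.
rewrite mulrDr -scalerAr T_lin !evaluation_prepend //.
(* The scalar part of [l] is handled by the rotation clause, its part in [S s] by the merging
   clause. *)
have -> : prepend (form_app phi) l (rcons w (letter_in (red s r))) =
    prepend (form_app phi) (val (red s r) * l) w.
  rewrite {2}(split_unit l) mulrDr -scalerAr mulr1 prepend_lin // prepend_val.
  by rewrite -phi_odd // -phi_rot.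
rewrite -prepend_lin //; congr prepend.
by rewrite {3}(split_unit r) mulrDl -scalerAl mul1r.
Qed.

(** For a single letter [x], both sides are sandwiches with the same middle, and their values agree
    by associativity: [(r * x) * l = r * (x * l)]. A general word is then moved letter by letter. *)
Lemma evaluation_trace p q : T phi (p * q) = T phi (q * p).
Proof.
have [T_lin _ _] := evalT.
have T_letter s (x : alg s) r : T phi (r * iota s x) = T phi (iota s x * r).
  move: r; apply: word_ind => [c r r' IHr IHr'|w w_alt].
    by rewrite mulrDl mulrDr -scalerAl -scalerAr !T_lin IHr IHr'.
  have [l [r [v [-> v_in]]]] := word_prod_sandwich s w_alt.
  rewrite -mulrA -rmorphM evaluation_sandwich // 2!mulrA -rmorphM.
  by rewrite evaluation_sandwich // mulrA.
move: q p; apply: word_ind => [c q q' IHq IHq' p|w _].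
  by rewrite mulrDl mulrDr -scalerAl -scalerAr !T_lin IHq IHq'.
elim: w => [|[s x] w IHw] p; first by rewrite word_prod_nil mulr1 mul1r.
by rewrite (@word_prod_cons s x w) mulrA IHw mulrA T_letter mulrA.
Qed.

End TraceCriterion.

Lemma alternates_last x w : alternates (x :: w) ->
  tag (last x w) = tag x (+) odd (size w).
Proof.
elim: w x => [|y w IHw] x; first by rewrite addbF.
rewrite /alternates /= => /andP[xy w_alt]; rewrite IHw //.
by case: (tag x) (tag y) xy (odd _) => -[] // _ [].
Qed.

(** Since there are only two factors, both end letters lie in the one different from [alg s], and
    tags alternate with the position. *)
Lemma inner_odd s w : inner s w -> odd (size w).
Proof.
case/lastP: w => // w z /and4P[_]; rewrite rev_rcons size_rcons.
case: w => //= x w w_alt xs zs; have := alternates_last w_alt.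
rewrite last_rcons size_rcons /= negbK => zx.
by move: xs zs; rewrite zx; case: (tag x) (s) (odd _) => -[] [].
Qed.

(** * A cyclic form with prescribed values on the factors and on even words *)

Section CyclicFormExists.
Variables (V : lmodType k) (cl : forall s, alg s -> V).
Variable even_form : seq letter -> V.

Hypothesis cl_lin : forall s, linear (@cl s).
Hypothesis cl_trace : forall s (x y : alg s), cl (x * y) = cl (y * x).
Hypothesis cl_unit : cl (1 : alg true) = cl (1 : alg false).
Hypothesis even_form_lin : forall u s c (x y : subspace (S s)) v,
  odd (size u + size v) ->
  even_form (u ++ letter_in (c *: x + y) :: v) =
  c *: even_form (u ++ letter_in x :: v) + even_form (u ++ letter_in y :: v).
Hypothesis even_form_rot : forall x w, odd (size w) ->
  even_form (rcons w x) = even_form (x :: w).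

(* On an odd word [x v z], whose end letters lie in the same algebra, [z] is
   moved to the front and multiplied with [x].  The first argument bounds the
   depth of the recursion. *)
Fixpoint odd_form n (w : seq letter) : V :=
  match w, n with
  | [::], _ => 0
  | [:: x], _ => cl (val (tagged x))
  | _, 0%N => 0
  | x :: w', m.+1 =>
    let z := last x w' in let v := behead (belast x w') in
    if tag z == tag x then
      let y := head_part (tag x) [:: z] * val (tagged x) in
      eps (tag x) y *: odd_form m v + even_form (letter_in (red (tag x) y) :: v)
    else 0
  end.

Lemma odd_form_step n s (x : subspace (S s)) v z :
  odd_form n.+1 (letter_in x :: rcons v z) =
  if tag z == s then
    eps s (head_part s [:: z] * val x) *: odd_form n v +
    even_form (letter_in (red s (head_part s [:: z] * val x)) :: v)
  else 0.
Proof.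
rewrite [LHS]/=; case E: (rcons v z) => [|y w]; first by case: v E.
by rewrite -E last_rcons belast_rcons.
Qed.

Lemma merge_lin s c (x y : alg s) (v : V) w : odd (size w) ->
  let f z := eps s z *: v + even_form (letter_in (red s z) :: w) in
  f (c *: x + y) = c *: f x + f y.
Proof.
move=> w_odd /=; rewrite (linearP (eps s)) (linearP (red s)).
rewrite (@even_form_lin [::]) // scalerDl scalerDr scalerA -!addrA.
by congr (_ + _); rewrite addrCA.
Qed.

(** The varied letter is the first, the last or an interior one. At either end it enters through the
    merged product, to which [merge_lin] applies; in the interior it is handled by the induction
    hypothesis and by linearity of [even_form]. *)
Lemma odd_form_lin n u s c (x y : subspace (S s)) v :
  ~~ odd (size u + size v) ->
  odd_form n (u ++ letter_in (c *: x + y) :: v) =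
  c *: odd_form n (u ++ letter_in x :: v) + odd_form n (u ++ letter_in y :: v).
Proof.
elim: n u v => [|n IHn] u v.
  case: u v => [|x' [|y' u]] [|z v] //= _; rewrite ?scaler0 ?addr0 //.
  exact: cl_lin.
case: u => [|[t x'] u].
  case/lastP: v => [_|v z v_odd]; first exact: cl_lin.
  rewrite size_rcons /= negbK in v_odd.
  rewrite !cat0s !odd_form_step; case: ifP => _; last first.
    by rewrite scaler0 addr0.
  rewrite (_ : _ * val _ = c *: (head_part s [:: z] * val x) +
    head_part s [:: z] * val y); first exact: merge_lin.
  by rewrite linearP mulrDr -scalerAr.
case/lastP: v => [|v z] uv_even.
  have u_odd : odd (size u) by move: uv_even; rewrite addn0 /= negbK.
  rewrite !cats1 !rcons_cons.
  rewrite !(@odd_form_step n t x'); case: ifP => [|_]; last first.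
    by rewrite scaler0 addr0.
  move=> /eqP ts; have {}ts : s = t := ts; subst t.
  rewrite !(head_part_cons _ [::]).
  rewrite (_ : val _ * _ = c *: (val x * val x') + val y * val x').
    exact: merge_lin.
  by rewrite linearP mulrDl -scalerAl.
have {}uv_even : ~~ odd (size u + size v).
  by move: uv_even; rewrite size_rcons addnS /= !negbK.
rewrite -!rcons_cons -!rcons_cat !cat_cons !rcons_cons.
rewrite !(@odd_form_step n t x'); case: ifP => _; last first.
  by rewrite scaler0 addr0.
rewrite /= IHn // -!cat_cons even_form_lin //.
rewrite !scalerDr !scalerA (mulrC c) -!addrA; congr (_ + _).
by rewrite addrCA.
Qed.

(** A unit of fuel strips two letters, so fuel one less than the length is ample. *)
Lemma odd_form_fuel m n w :
  (size w <= m.+1)%N -> (size w <= n.+1)%N -> odd_form m w = odd_form n w.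
Proof.
elim: m n w => [|m IHm] [|n] [|[s x] w] //; try by case: w.
case/lastP: w => // w z wm wn; rewrite /= size_rcons !ltnS in wm wn.
rewrite !(@odd_form_step _ s x); case: ifP => //= _.
by rewrite (IHm n) // ltnW.
Qed.

(** The empty word stands for [1], which lies in both factors; [cl_unit] makes the choice of
    [alg true] immaterial. *)
Definition trace_fun (w : seq letter) : V :=
  if ~~ alternates w then 0
  else if odd (size w) then odd_form (size w) w
  else if w is [::] then cl (1 : alg true) else even_form w.

Fact trace_fun_lin : multilinear_form trace_fun.
Proof.
move=> u s c x y v; rewrite /trace_fun.
rewrite -(alternates_subst u x) (alternates_subst u y x).
case: ifP => _; first by rewrite scaler0 addr0.
have sz z : size (u ++ @letter_in s z :: v) = (size u + size v).+1.
  by rewrite size_cat addnS.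
rewrite !sz; case: ifP => uv; first exact: odd_form_lin.
by case: (u) (@even_form_lin u s c x y v (negbFE uv)) => [|x' u'].
Qed.

Fact trace_fun_alt w : ~~ alternates w -> trace_fun w = 0.
Proof. by rewrite /trace_fun => ->. Qed.

Definition trace_form : form V := mk_form trace_fun_lin trace_fun_alt.

Lemma trace_form_odd w : alternates w -> odd (size w) ->
  form_app trace_form w = odd_form (size w) w.
Proof. by rewrite -[form_app _]/trace_fun /trace_fun => -> ->. Qed.

Lemma trace_form_even x w : alternates (x :: w) -> odd (size w) ->
  form_app trace_form (x :: w) = even_form (x :: w).
Proof. by rewrite -[form_app _]/trace_fun /trace_fun => -> /= ->. Qed.

Lemma trace_form_nil s (x : alg s) :
  prepend (form_app trace_form) x [::] = cl x.
Proof.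
rewrite /prepend (@trace_form_odd [:: _]) //=.
rewrite -[form_app _ _]/(cl (1 : alg true)).
have -> : cl (1 : alg true) = cl (1 : alg s) by case: (s).
by rewrite -cl_lin -split_unit.
Qed.

(** The three clauses come from [cl_trace], from [even_form_rot], since a letter and an inner word
    together have even length, and from the recursion defining [odd_form]. *)
Lemma trace_form_cyclic : cyclic_form trace_form.
Proof.
split=> [s x y|s x w w_in|s x y w w_in].
- by rewrite !trace_form_nil cl_trace.
- have w_odd := inner_odd w_in; have /and4P[w0 w_alt ws sw] := w_in.
  have xw_alt : alternates (letter_in x :: w) by rewrite alternates_cons ws.
  have wx_alt : alternates (rcons w (letter_in x)).
    by rewrite alternates_rcons sw.
  rewrite trace_form_even // -even_form_rot //.
  case: w wx_alt w0 w_odd {w_in w_alt ws sw xw_alt} => // y w w_alt _ w_odd.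
  by rewrite rcons_cons trace_form_even // size_rcons.
have w_odd := inner_odd w_in; have /and4P[w0 w_alt ws sw] := w_in.
have aw_alt a : alternates (@letter_in s a :: w) by rewrite alternates_cons ws.
rewrite trace_form_odd; first last.
- by rewrite /= size_rcons /= negbK.
- rewrite alternates_cons alternates_rcons sw w_alt !andbT.
  by case: (w) w0 ws.
rewrite odd_form_step eqxx head_part_cons /prepend.
rewrite trace_form_even // trace_form_odd //; congr (_ *: _ + _).
(* The recursion leaves fuel [size (rcons w (letter_in y))], one more than the [size w] built into
   [trace_form]. *)
by apply: odd_form_fuel; rewrite ?leqnSn // -/(size _) size_rcons ltnW.
Qed.

(** The existence half of the argument: values respecting the evident relations extend to a trace,
    so the cocenter has no further relations. *)
Lemma trace_exists : exists tau : P -> V,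
  [/\ linear tau, forall p q, tau (p * q) = tau (q * p),
      forall s x, tau (iota s x) = cl x
    & forall x w, alternates (x :: w) -> odd (size w) ->
        tau (word_prod (x :: w)) = even_form (x :: w)].
Proof.
have [T evalT] := form_evaluation_exists V; have [T_lin _ _] := evalT.
exists (T trace_form); split=> // [p q|s x|x w w_alt w_odd].
- exact: (evaluation_trace evalT trace_form_cyclic).
- rewrite -(trace_form_nil x) -(evaluation_prepend _ evalT) //.
  by rewrite word_prod_nil mulr1.
by rewrite (evaluation_word _ evalT) // trace_form_even.
Qed.

End CyclicFormExists.

(** The uniqueness half. By cyclicity an odd word [x w z] has the same trace as [(z x) w], and
    splitting [z x] along [k 1] gives an even word plus a multiple of the shorter odd word [w];
    hence strong induction on the length. *)
Lemma trace_ext (V : lmodType k) (tau tau' : P -> V) :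
  linear tau -> linear tau' ->
  (forall p q, tau (p * q) = tau (q * p)) ->
  (forall p q, tau' (p * q) = tau' (q * p)) ->
  (forall s x, tau (iota s x) = tau' (iota s x)) ->
  (forall x w, alternates (x :: w) -> odd (size w) ->
     tau (word_prod (x :: w)) = tau' (word_prod (x :: w))) ->
  tau =1 tau'.
Proof.
move=> lin lin' tr tr' eq_iota eq_even.
apply: word_ind => [c p q IHp IHq|w]; first by rewrite lin lin' IHp IHq.
have [n] := ubnP (size w); elim: n w => // n IHn [|[s x] w] /=.
  by move=> _ _; rewrite word_prod_nil -(rmorph1 (iota true)) eq_iota.
rewrite ltnS => w_n xw_alt; have [w_odd|w_even] := boolP (odd (size w)).
  exact: eq_even.
case/lastP: w => [|w [t z]] in w_n xw_alt w_even *.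
  by rewrite (@word_prod_cons s x) word_prod_nil mulr1.
(* In a word of odd length the two end letters lie in the same algebra. *)
have := alternates_last xw_alt.
rewrite last_rcons (negPf w_even) addbF /= => ts.
subst t; move: xw_alt w_n w_even; rewrite (@alternates_cons s x).
rewrite (@alternates_rcons s z) size_rcons /= negbK.
move=> /and3P[ws sw w_alt] w_n w_odd.
have {}ws : avoids_head s w by case: (w) ws w_odd.
rewrite (@word_prod_cons s x) (@word_prod_rcons s z) mulrA tr tr' iota_mulA.
rewrite iota_split mulrDl -scalerAl mul1r lin lin' -word_prod_cons.
by rewrite eq_even ?alternates_cons ?ws // IHn // ltnW.
Qed.

(** * From traces to the cocenter *)

Section CocenterIso.
Variables (V : lmodType k) (cl : forall s, alg s -> V).
Variables (even_form : seq letter -> V) (psi : V -> cocenter P).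

Hypothesis cl_lin : forall s, linear (@cl s).
Hypothesis cl_trace : forall s (x y : alg s), cl (x * y) = cl (y * x).
Hypothesis cl_unit : cl (1 : alg true) = cl (1 : alg false).
Hypothesis even_form_lin : forall u s c (x y : subspace (S s)) v,
  odd (size u + size v) ->
  even_form (u ++ letter_in (c *: x + y) :: v) =
  c *: even_form (u ++ letter_in x :: v) + even_form (u ++ letter_in y :: v).
Hypothesis even_form_rot : forall x w, odd (size w) ->
  even_form (rcons w x) = even_form (x :: w).
Hypothesis target_generated : forall Q : V -> Prop, linear_property Q ->
  (forall s (x : alg s), Q (cl x)) ->
  (forall x w, alternates (x :: w) -> odd (size w) -> Q (even_form (x :: w))) ->
  forall v, Q v.
Hypothesis psi_lin : linear psi.
Hypothesis psi_cl : forall s (x : alg s),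
  psi (cl x) = cocenter_class (iota s x).
Hypothesis psi_even : forall x w, alternates (x :: w) -> odd (size w) ->
  psi (even_form (x :: w)) = cocenter_class (word_prod (x :: w)).

(** [phi] is induced by the trace with the prescribed values and [psi] is its inverse: one composite
    is the identity by [trace_ext], the other because the target is generated by the values of [cl]
    and [even_form]. *)
Lemma cocenter_iso : exists phi : {linear cocenter P -> V},
  [/\ bijective phi,
      forall s (x : alg s), phi (cocenter_class (iota s x)) = cl x
    & forall x w, alternates (x :: w) -> odd (size w) ->
        phi (cocenter_class (word_prod (x :: w))) = even_form (x :: w)].
Proof.
have [tau [tau_lin tau_trace tau_unit tau_even]] :=
  trace_exists cl_lin cl_trace cl_unit even_form_lin even_form_rot.
have [|phi phiE] := @quotv_desc k P V (@is_commutator k P) tau tau_lin.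
  move=> _ [x [y ->]]; rewrite -scaleN1r addrC tau_lin tau_trace scaleN1r.
  by rewrite addNr.
exists phi; split=> [|s x|x w w_alt w_odd]; last 2 first.
- by rewrite phiE tau_unit.
- by rewrite phiE tau_even.
exists psi.
  apply: quotv_ind => p; rewrite phiE.
  apply: (@trace_ext _ (psi \o tau) (@cocenter_class k P)).
  - by move=> c x y; rewrite /= tau_lin psi_lin.
  - exact: linearP.
  - by move=> x y; rewrite /= tau_trace.
  - exact: cocenter_classC.
  - by move=> s x; rewrite /= tau_unit psi_cl.
  by move=> x w w_alt w_odd; rewrite /= tau_even // psi_even.
apply: target_generated => [|s x|x w w_alt w_odd].
- apply: (@linear_property_eq _ _ _ (phi \o psi) idfun) => // c x y.
  by rewrite /= psi_lin linearP.
- by rewrite psi_cl phiE tau_unit.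
by rewrite psi_even // phiE tau_even.
Qed.

End CocenterIso.

End Evaluation.
End FreeProductWords.

(** * Even words as cyclic tensors *)

Section CyclicWords.
Variables (k : fieldType) (A B : algType k).
Variables (A0 : submodClosed A) (B0 : submodClosed B).

Definition factor (s : bool) : algType k := if s then A else B.

Definition factor_compl (s : bool) : submodClosed (factor s) :=
  if s return submodClosed (factor s) then A0 else B0.

Local Notation L := (letter factor_compl).
Local Notation inA := (@letter_in k factor factor_compl true).
Local Notation inB := (@letter_in k factor factor_compl false).

Definition pair_word (ps : seq (subspace A0 * subspace B0)) : seq L :=
  flatten [seq [:: inA p.1; inB p.2] | p <- ps].

Lemma pair_word_cons p ps :
  pair_word (p :: ps) = [:: inA p.1, inB p.2 & pair_word ps].
Proof. by []. Qed.

Lemma alternates_pair_word ps : alternates (pair_word ps).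
Proof.
elim: ps => // p ps IHps; rewrite pair_word_cons (@alternates_cons _ _ _ true).
by rewrite (@alternates_cons _ _ _ false) IHps andbT /=; case: ps {IHps}.
Qed.

Lemma pair_wordP x w : alternates (x :: w) -> odd (size w) -> tag x = true ->
  exists ps, x :: w = pair_word ps.
Proof.
have [n] := ubnP (size w); elim: n x w => // n IHn [s a] [|[t b] w] //=.
rewrite ltnS => w_n; rewrite (@alternates_cons _ _ _ s) => /andP[/= ts w_alt].
move=> w_even s1; subst s; case: t b ts w_alt => // b _ w_alt.
case: w w_n w_alt w_even => [|y w] w_n w_alt w_odd.
  by exists [:: (a, b)].
move: w_alt; rewrite (@alternates_cons _ _ _ false) => /andP[y1 w_alt].
have y_true : tag y = true by case: (tag y) (y1 : tag y != false).
have [ps ->] := IHn y w (ltnW w_n) w_alt (negbNE w_odd) y_true.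
by exists ((a, b) :: ps).
Qed.

Lemma size_pair_word ps : size (pair_word ps) = (size ps).*2.
Proof. by elim: ps => //= p ps ->; rewrite doubleS. Qed.

Lemma nth_pair_word x0 p0 ps i : (i < size ps)%N ->
  nth x0 (pair_word ps) i.*2 = inA (nth p0 ps i).1 /\
  nth x0 (pair_word ps) i.*2.+1 = inB (nth p0 ps i).2.
Proof.
by elim: ps i => [|p ps IHps] [|i] //; rewrite ltnS pair_word_cons; apply: IHps.
Qed.

(** The default [0] makes the tensor of a word vanish as soon as a letter sits at a position
    reserved for the other factor. *)
Definition part s (x : L) : subspace (factor_compl s) :=
  untag 0 (fun u : subspace (factor_compl s) => u) x.

Lemma part_in s (u : subspace (factor_compl s)) : part s (letter_in u) = u.
Proof. by rewrite /part (untagE _ _ (erefl : tag (letter_in u) = s)). Qed.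

Lemma part_out s (x : L) : tag x != s -> part s x = 0.
Proof. exact: untag_dflt. Qed.

Lemma part_lin s t c (x y : subspace (factor_compl t)) :
  part s (letter_in (c *: x + y)) =
  c *: part s (letter_in x) + part s (letter_in y).
Proof.
have [ts|ts] := eqVneq t s; first by subst t; rewrite !part_in.
by rewrite !part_out // scaler0 addr0.
Qed.

Local Notation "w `_ i" := (nth (inA 0) w i).

Definition word_tensor n (w : seq L) (i : 'I_n.+1) :
    tensor (subspace A0) (subspace B0) :=
  tens (part true w`_i.*2) (part false w`_i.*2.+1).

Definition cyclic_in n
    (t : tensor_power (tensor (subspace A0) (subspace B0)) n.+1) :
    direct_sum (cyclic_words A0 B0) :=
  direct_sum_in (cyclic_words A0 B0) n (cyclic_class t).

Lemma cyclic_in_linear n : linear (@cyclic_in n).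
Proof. by move=> c t t'; rewrite /cyclic_in linearP direct_sum_in_linear. Qed.

Definition cyclic_word n (w : seq L) : direct_sum (cyclic_words A0 B0) :=
  cyclic_in (tensors [ffun i : 'I_n.+1 => word_tensor w i]).

(** The letter at position [size u] enters only the tensor factor of index [(size u)./2], on the
    left or on the right according to the parity of [size u]. The bound on [size u] keeps that index
    in range. *)
Lemma cyclic_word_lin n u t c (x y : subspace (factor_compl t)) v :
  (size u < n.*2.+2)%N ->
  cyclic_word n (u ++ letter_in (c *: x + y) :: v) =
  c *: cyclic_word n (u ++ letter_in x :: v) +
  cyclic_word n (u ++ letter_in y :: v).
Proof.
move=> u_n; pose W z := u ++ @letter_in k factor factor_compl t z :: v.
have i0_lt : ((size u)./2 < n.+1)%N by rewrite ltn_half_double doubleS.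
pose i0 := Ordinal i0_lt; pose f := [ffun i : 'I_n.+1 => word_tensor (W x) i].
have Wne z j : j != size u -> (W z)`_j = (W x)`_j.
  move=> ju; rewrite /W !nth_cat; case: ltnP => // uj.
  by case E: (j - size u)%N => //; rewrite eqn_leq uj -subn_eq0 E in ju.
have Weq z : (W z)`_(size u) = letter_in z by rewrite /W nth_cat ltnn subnn.
have uE : size u = (odd (size u) + i0.*2)%N by rewrite /= odd_double_half.
have WE z : [ffun i : 'I_n.+1 => word_tensor (W z) i] =
    set_factor f i0 (word_tensor (W z) i0).
  apply/ffunP => i; rewrite !ffunE; case: eqVneq => [-> //|i_i0].
  rewrite /word_tensor !Wne //; apply: contraNneq i_i0 => iE; apply/eqP/val_inj.
    by rewrite /= -iE /= ?uphalf_double ?doubleK.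
  by rewrite /= -iE /= ?uphalf_double ?doubleK.
rewrite /cyclic_word !WE.
have -> : word_tensor (W (c *: x + y)) i0 =
    c *: word_tensor (W x) i0 + word_tensor (W y) i0.
  rewrite /word_tensor; have [u_odd|u_even] := boolP (odd (size u)).
    have ne : i0.*2 != size u by rewrite uE u_odd neq_ltn ltnSn.
    have -> : i0.*2.+1 = size u by rewrite uE u_odd.
    by rewrite !Weq !(Wne _ _ ne) part_lin tens_linr.
  have eq : i0.*2 = size u by rewrite uE (negPf u_even).
  have ne : i0.*2.+1 != size u by rewrite -eq neq_ltn ltnSn orbT.
  by rewrite !(Wne _ _ ne) eq !Weq part_lin tens_linl.
by rewrite tensors_multilinear cyclic_in_linear.
Qed.

Lemma cyclic_in_act n g t : @cyclic_in n (cyclic_action g t) = cyclic_in t.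
Proof.
congr direct_sum_in; apply/eqP.
rewrite /cyclic_class /coinvariants_class quotv_class_eq.
by apply: linear_span_incl; exists g, t.
Qed.

(** Moving a pair of letters from the front to the end shifts the tensor factors by one place. This
    is the action of the generator [inZp 1], which is trivial on coinvariants. *)
Lemma cyclic_word_rot n x y w : size w = n.*2 ->
  cyclic_word n (w ++ [:: x; y]) = cyclic_word n (x :: y :: w).
Proof.
move=> w_n; rewrite /cyclic_word -[RHS](cyclic_in_act (inZp 1)).
rewrite cyclic_actionE; congr (cyclic_in (tensors _)).
apply/ffunP => i; rewrite !ffunE /word_tensor /= modnDmr addn1.
have [i_n|i_n] := ltnP i n.
  rewrite modn_small ?ltnS // doubleS /= !nth_cat w_n.
  by rewrite -doubleS leq_double i_n ltn_double i_n.
have {i_n} -> : val i = n by apply/eqP; rewrite eqn_leq i_n -ltnS ltn_ord.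
by rewrite modnn /= !nth_cat w_n ltnn subnn ltnNge leqnSn subSnn.
Qed.

Lemma cyclic_word_eq0 n w : tag w`_0 != true -> cyclic_word n w = 0.
Proof.
move=> w0; rewrite /cyclic_word (@tensors_eq0 _ _ _ _ ord0).
  exact/linear_fun0/cyclic_in_linear.
by rewrite ffunE /word_tensor part_out // tens0l.
Qed.

(* For an alternating [w] only one of the two words starts with a letter of
   [A]; the other one has zero parts, so its cyclic word vanishes. *)
Definition even_cyclic_word (w : seq L) :=
  cyclic_word (size w)./2.-1 w + cyclic_word (size w)./2.-1 (rot 1 w).

Lemma even_cyclic_word_lin u t c (x y : subspace (factor_compl t)) v :
  odd (size u + size v) ->
  even_cyclic_word (u ++ letter_in (c *: x + y) :: v) =
  c *: even_cyclic_word (u ++ letter_in x :: v) +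
  even_cyclic_word (u ++ letter_in y :: v).
Proof.
move=> uv_odd; rewrite /even_cyclic_word.
have sz z : (size (u ++ @letter_in k factor factor_compl t z :: v))./2.-1 =
    (size u + size v)./2.
  by rewrite size_cat /= addnS -[(_ + _)%N in LHS]odd_double_half uv_odd
             -doubleS doubleK.
have uvE : (size u + size v)%N = (size u + size v)./2.*2.+1.
  by rewrite -[LHS]odd_double_half uv_odd.
rewrite !{}sz; move: (_./2) uvE => n uvE.
have u_n : (size u < n.*2.+2)%N by rewrite ltnS -uvE leq_addr.
rewrite cyclic_word_lin // scalerDr -!addrA; congr (_ + _).
(* In the rotated word the varied letter comes last if [u] is empty; otherwise it has moved one
   place to the left. *)
rewrite [RHS]addrCA; congr (_ + _); case: u u_n uvE {uv_odd} => [|z u] u_n uvE.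
  by rewrite /rot /= !drop0 cyclic_word_lin // -uvE.
rewrite /rot /= !drop0 !take0 -!catA cyclic_word_lin //.
exact: ltn_trans u_n.
Qed.

(** Rotation by one letter exchanges the two summands, up to a rotation by a whole pair in one of
    them. *)
Lemma even_cyclic_word_rot x w : odd (size w) ->
  even_cyclic_word (rcons w x) = even_cyclic_word (x :: w).
Proof.
case: w => // y w; rewrite /even_cyclic_word size_rcons /= => w_even.
rewrite /rot /= !drop0 !take0 addrC !cats1; congr (_ + _).
rewrite -cyclic_word_rot; first by rewrite -!cats1 -catA.
by rewrite -[LHS]odd_double_half (negPf w_even).
Qed.

Lemma even_pair_word n
    (a : 'I_n.+1 -> subspace A0) (b : 'I_n.+1 -> subspace B0) :
  even_cyclic_word (pair_word [seq (a i, b i) | i <- enum 'I_n.+1]) =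
  cyclic_in (tensors [ffun i => tens (a i) (b i)]).
Proof.
set ps := map _ _.
have szps : size ps = n.+1 by rewrite size_map size_enum_ord.
rewrite /even_cyclic_word size_pair_word szps doubleK /=.
(* The rotated word starts with a letter of [B], so the second summand vanishes. *)
rewrite (@cyclic_word_eq0 n (rot 1 _)) ?addr0; last first.
  by case: ps szps => // p ps' _; rewrite pair_word_cons /rot.
congr (cyclic_in (tensors _)); apply/ffunP => i.
rewrite !ffunE /word_tensor.
have i_ps : (i < size ps)%N by rewrite szps.
have [-> ->] := @nth_pair_word (inA 0) (a ord0, b ord0) ps i i_ps.
by rewrite !part_in (nth_map ord0) ?size_enum_ord // nth_ord_enum.
Qed.

Lemma even_pair_wordP n
    (a : 'I_n.+1 -> subspace A0) (b : 'I_n.+1 -> subspace B0) :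
  exists x w, [/\ alternates (x :: w), odd (size w),
    x :: w = pair_word [seq (a i, b i) | i <- enum 'I_n.+1]
    & even_cyclic_word (x :: w) =
      cyclic_in (tensors [ffun i => tens (a i) (b i)])].
Proof.
rewrite -even_pair_word; set ps := map _ _.
have := size_pair_word ps; have := alternates_pair_word ps.
rewrite size_map size_enum_ord; case: (pair_word ps) => // x w xw_alt [w_n].
by exists x, w; split=> //; rewrite w_n /= odd_double.
Qed.

End CyclicWords.

(** * Ordered products and their rotations *)

Section OrderedProducts.
Variables (k : fieldType) (P : algType k).

(** As the factors do not commute, the index list is cut at [i]: the product is [l * m u * r] with
    [l] and [r] independent of the varied [u]. *)
Lemma prod_multilinear (U : lmodType k) (m : {linear U -> P}) n :
  multilinear_map (fun f : {ffun 'I_n -> U} => \prod_i m (f i)).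
Proof.
move=> f i c v v'.
have [l [r lr]] : exists l r, forall u,
    \prod_j m (set_factor f i u j) = l * m u * r.
  rewrite /index_enum -enumT.
  move: (enum 'I_n) (enum_uniq 'I_n) (mem_enum 'I_n i).
  move=> s s_uniq s_i; have {s_i} /splitPr s12 : i \in s by rewrite s_i.
  case: s12 s_uniq => s1 s2; rewrite cat_uniq /= => /and4P[_ i_s1 i_s2 _].
  exists (\prod_(j <- s1) m (f j)), (\prod_(j <- s2) m (f j)) => u.
  rewrite big_cat big_cons /= ffunE eqxx mulrA; congr (_ * _ * _).
    apply: eq_big_seq => j j_s1; rewrite ffunE; case: eqP => // ji.
    by move: i_s1; rewrite -ji j_s1.
  apply: eq_big_seq => j j_s2; rewrite ffunE; case: eqP => // ji.
  by move: i_s2; rewrite -ji j_s2.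
by rewrite !lr linearP mulrDr mulrDl -scalerAr -scalerAl.
Qed.

(** Adding [g] modulo [n.+1] shifts the enumeration, and the entries past the end wrap around to the
    front. *)
Lemma rot_enum n (g : 'I_n.+1) (T : Type) (F : 'I_n.+1 -> T) :
  [seq F (i + g) | i <- enum 'I_n.+1] = rot g [seq F i | i <- enum 'I_n.+1].
Proof.
rewrite -map_rot (map_comp F (fun i => i + g)); congr map.
apply: (@eq_from_nth _ ord0).
  by rewrite size_rot size_map.
rewrite size_map size_enum_ord => i i_n; pose j := Ordinal i_n.
rewrite (nth_map ord0) ?size_enum_ord //.
have -> : nth ord0 (enum 'I_n.+1) i = j by rewrite -[i]/(val j) nth_ord_enum.
apply: val_inj; rewrite /rot nth_cat size_drop size_enum_ord ltn_subRL /= addnC.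
case: ltnP => ig; first by rewrite nth_drop nth_enum_ord // modn_small.
have g_n := ltn_ord g.
have lt_n : (i - (n.+1 - g) < g)%N by lia.
rewrite nth_take // nth_enum_ord ?(ltn_trans lt_n) //.
have -> : (g + i = (i - (n.+1 - g)) + n.+1)%N.
  by lia.
by rewrite modnDr modn_small // (ltn_trans lt_n).
Qed.

Lemma prod_rot n (F : 'I_n.+1 -> P) g :
  cocenter_class (\prod_i F (i + g)) = cocenter_class (\prod_i F i).
Proof.
have E G : \prod_(i < n.+1) G i =
    \prod_(x <- [seq G i | i <- enum 'I_n.+1]) x :> P.
  by rewrite big_map /index_enum -enumT.
rewrite !E rot_enum /rot; move: [seq F i | i <- _] => s.
by rewrite big_cat cocenter_classC -big_cat cat_take_drop.
Qed.

End OrderedProducts.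

(** * The cocenter of a free product *)

Section Assembly.
Variables (k : fieldType) (A B : algType k).
Variables (A0 : submodClosed A) (B0 : submodClosed B).

Local Notation target :=
  (glued_cocenters A B * direct_sum (cyclic_words A0 B0))%type.

Definition glued_fun s : factor A B s -> glued_cocenters A B :=
  match s with
  | true => fun a : A => glued_class (cocenter_class a, 0)
  | false => fun b : B => glued_class (0, cocenter_class b)
  end.

Lemma glued_fun_linear s : linear (@glued_fun s).
Proof.
case: s => c x y /=; rewrite -linearP; congr glued_class;
  rewrite -[RHS]/(_ *: _ + _, _ *: _ + _) linearP //=; congr (_, _);
  by rewrite scaler0 addr0.
Qed.

Definition glued_part s (x : factor A B s) : target := (glued_fun x, 0).

Lemma glued_part_linear s : linear (@glued_part s).
Proof. by move=> c x y; rewrite /glued_part glued_fun_linear pair0_linear. Qed.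

HB.instance Definition _ s := GRing.isLinear.Build k (factor A B s) target *:%R
  (@glued_part s) (@glued_part_linear s).

Lemma glued_part_trace s (x y : factor A B s) :
  glued_part (x * y) = glued_part (y * x).
Proof.
by congr pair; case: s x y => x y; congr glued_class; congr pair;
  apply: cocenter_classC.
Qed.

Lemma glued_part_unit :
  glued_part (1 : factor A B true) = glued_part (1 : factor A B false).
Proof.
congr pair; apply/eqP; rewrite /= /glued_class quotv_class_eq.
apply: linear_span_incl; rewrite /unit_gluing.
by congr pair; rewrite ?subr0 ?sub0r.
Qed.

Lemma target_ind (Q : target -> Prop) : linear_property Q ->
  (forall s (x : factor A B s), Q (glued_part x)) ->
  (forall n a b,
     Q (0, @cyclic_in _ _ _ A0 B0 n (tensors [ffun i => tens (a i) (b i)]))) ->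
  forall x, Q x.
Proof.
move=> Q_lin Qg Qc [g d].
have [Q0 Q_clos] := Q_lin.
have Q_add x y : Q x -> Q y -> Q (x + y).
  by move=> Qx Qy; rewrite -[x]scale1r; apply: Q_clos.
have pair0_add x y : (x + y, 0) = (x, 0) + (y, 0) :> target.
  by rewrite -[x in LHS]scale1r pair0_linear scale1r.
have -> : (g, d) = (g, 0) + (0, d) :> target.
  by rewrite -[RHS]/(g + 0, 0 + d) addr0 add0r.
apply: (Q_add).
  move: g; apply: quotv_ind => -[x y]; move: x y.
  apply: quotv_ind => a; apply: quotv_ind => b.
  set ca := quotv_class _ a; set cb := quotv_class _ b.
  have -> : (ca, cb) = (ca, 0) + (0, cb) :> cocenter A * cocenter B.
    by rewrite -[RHS]/(ca + 0, 0 + cb) addr0 add0r.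
  rewrite raddfD pair0_add.
  by apply: (Q_add); [apply: (Qg true)|apply: (Qg false)].
move: d; apply: direct_sum_ind.
  exact: (linear_property_comp (@pair0r_linear k _ _)).
move=> n; apply: quotv_ind; apply: tensor_power_tens_ind => [|a b].
  apply: (@linear_property_comp k _ _
    (fun t => (0, @cyclic_in _ _ _ A0 B0 n t))) => //.
  by move=> c t t'; rewrite cyclic_in_linear pair0r_linear.
exact: Qc.
Qed.

Section Inverse.
Variables (P : algType k) (iA : {lrmorphism A -> P}) (iB : {lrmorphism B -> P}).

Definition factor_incl s : {lrmorphism factor A B s -> P} :=
  match s with true => iA | false => iB end.

Lemma glued_desc : exists g : {linear glued_cocenters A B -> cocenter P},
  forall s (x : factor A B s),
    g (glued_fun x) = cocenter_class (factor_incl s x).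
Proof.
have desc (C : algType k) (i : {lrmorphism C -> P}) :
    exists g : {linear cocenter C -> cocenter P},
      forall x, g (cocenter_class x) = cocenter_class (i x).
  apply: (@quotv_desc k C (cocenter P) _ (fun x => cocenter_class (i x))).
    by move=> c x y; rewrite !linearP.
  move=> _ [x [y ->]]; have -> : i (x * y - y * x) = i x * i y - i y * i x.
    by rewrite rmorphB !rmorphM.
  by rewrite raddfB /= (cocenter_classC (i x)) subrr.
have [gA gAE] := desc A iA; have [gB gBE] := desc B iB.
have [|_ ->|g gE] := @quotv_desc k (cocenter A * cocenter B)%type (cocenter P)
  (@unit_gluing k A B) (fun x => gA x.1 + gB x.2).
- move=> c x y /=; rewrite (linearP gA) (linearP gB) scalerDr -!addrA.
  by congr (_ + _); rewrite addrCA.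
(* The gluing relation is killed because [iA] and [iB] both send [1] to [1]. *)
- have gBN y : gB (- y) = - gB y by apply: raddfN.
  by rewrite /= gBN gAE gBE !rmorph1 subrr.
exists g; case=> x; rewrite /= /glued_class gE /=.
  by rewrite raddf0 addr0.
by rewrite raddf0 add0r.
Qed.

Lemma tens_prod_desc :
  exists m : {linear tensor (subspace A0) (subspace B0) -> P},
  forall a b, m (tens a b) = iA (val a) * iB (val b).
Proof.
apply: (@tensor_desc k _ _ P (fun a b => iA (val a) * iB (val b)))
  => [b|a] c x y.
  by rewrite !linearP mulrDl -scalerAl.
by rewrite !linearP mulrDr -scalerAr.
Qed.

Lemma cyclic_desc n : exists g : {linear cyclic_words A0 B0 n -> cocenter P},
  forall a b, g (cyclic_class (tensors [ffun i => tens (a i) (b i)])) =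
    cocenter_class (\prod_(i < n.+1) (iA (val (a i)) * iB (val (b i)))).
Proof.
have [m mE] := tens_prod_desc.
have [|h hE] := @tensor_power_desc k _ n.+1 (cocenter P)
  (fun f => cocenter_class (\prod_i m (f i))).
  by move=> f i c v v'; rewrite prod_multilinear linearP.
have h_lin : linear h by exact: linearP.
(* The map descends to coinvariants because a product and its rotations have the same class in the
   cocenter. *)
have h_act g t : h (cyclic_action g t) = h t.
  move: t; apply: tensor_power_ind => [|f].
    apply: (@linear_property_eq k _ _ (h \o cyclic_action g)) => // c x y.
    by rewrite /= /cyclic_action (linearP (permute_factors _)) h_lin.
  rewrite cyclic_actionE !hE -(prod_rot (fun i => m (f i)) g).
  by congr cocenter_class; apply: eq_bigr => i _; rewrite ffunE.
have [|_ [g [t ->]]|g gE] := @quotv_desc k _ (cocenter P)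
  (coinvariant_relation
    (@cyclic_action k (tensor (subspace A0) (subspace B0)) n)) h.
- exact: h_lin.
- by rewrite -(subrr (h t)) -{1}(h_act g t); apply: raddfB.
exists g => a b; rewrite gE hE; congr cocenter_class.
by apply: eq_bigr => i _; rewrite ffunE mE.
Qed.

Lemma inverse_exists : exists psi : {linear target -> cocenter P},
  (forall s (x : factor A B s),
     psi (glued_part x) = cocenter_class (factor_incl s x)) /\
  forall n a b,
    psi (0, @cyclic_in _ _ _ A0 B0 n (tensors [ffun i => tens (a i) (b i)])) =
    cocenter_class (\prod_(i < n.+1) (iA (val (a i)) * iB (val (b i)))).
Proof.
(* Choice turns existence for each [n] into the family of maps required by [direct_sum_desc]. *)
have [g gE] := glued_desc; pose c n := projT1 (cid (cyclic_desc n)).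
have cE n := projT2 (cid (cyclic_desc n)).
have [d dE] := direct_sum_desc c.
pose psi (x : target) := g x.1 + d x.2.
have psi_lin : linear psi.
  move=> e x y; rewrite /psi (linearP g) (linearP d) scalerDr -!addrA.
  by congr (_ + _); rewrite addrCA.
exists (HB.pack_for {linear target -> cocenter P} psi
  (GRing.isLinear.Build k target (cocenter P) *:%R psi psi_lin)).
split=> [s x|n a b] /=; rewrite /psi /=.
  by rewrite gE raddf0 addr0.
by rewrite raddf0 add0r dE cE.
Qed.

End Inverse.
End Assembly.

(** * Even words and their classes in the cocenter *)

Lemma word_prod_pair_word (k : fieldType) (A B P : algType k)
    (A0 : submodClosed A) (B0 : submodClosed B)
    (iA : {lrmorphism A -> P}) (iB : {lrmorphism B -> P})
    (ps : seq (subspace A0 * subspace B0)) :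
  word_prod (factor_incl iA iB) (pair_word ps) =
  \prod_(p <- ps) (iA (val p.1) * iB (val p.2)).
Proof.
elim: ps => [|p ps IHps]; first by rewrite word_prod_nil big_nil.
rewrite pair_word_cons (@word_prod_cons k _ _ _ _ true).
by rewrite (@word_prod_cons k _ _ _ _ false) IHps big_cons mulrA.
Qed.

(** An even word starting in [B] is rotated by one letter so as to start in [A], which changes
    neither its cyclic word nor its class; it is then a word of pairs. *)
Lemma even_word_class (k : fieldType) (A B P : algType k)
    (A0 : submodClosed A) (B0 : submodClosed B)
    (iA : {lrmorphism A -> P}) (iB : {lrmorphism B -> P})
    (F : direct_sum (cyclic_words A0 B0) -> cocenter P) :
  (forall n a b,
    F (@cyclic_in _ _ _ A0 B0 n (tensors [ffun i => tens (a i) (b i)])) =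
    cocenter_class (\prod_(i < n.+1) (iA (val (a i)) * iB (val (b i))))) ->
  forall (x : letter (factor_compl A0 B0)) w,
    alternates (x :: w) -> odd (size w) ->
    F (even_cyclic_word (x :: w)) =
    cocenter_class (word_prod (factor_incl iA iB) (x :: w)).
Proof.
move=> FE x w; wlog x_true : x w / tag x = true => [H|].
  move=> xw_alt w_odd; have [/H -> //|/negPf x_false] := boolP (tag x).
  rewrite -even_cyclic_word_rot // -cat1s word_prod_cat cocenter_classC.
  rewrite -word_prod_cat cats1.
  case: w xw_alt w_odd => // y w xw_alt w_odd.
  have := xw_alt.
  rewrite rcons_cons {1}/alternates /= x_false => /andP[y_true w_alt].
  apply: H; rewrite ?size_rcons //; first by case: (tag y) y_true.
  case: x x_false xw_alt => [[] a] // _ xw_alt.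
  rewrite -rcons_cons (@alternates_rcons _ _ _ false) [alternates _]w_alt andbT.
  (* [w] has even length, so its last letter has the tag of [y], and the rotated word is again
     alternating. *)
  have : tag (last y w) = true.
    have w_even : odd (size w) = false by apply/negbTE.
    by rewrite alternates_last // w_even addbF; case: (tag y) y_true.
  case/lastP: (w) => [|v z];
    by rewrite ?last_rcons -?rcons_cons ?rev_rcons /= => ->.
move=> xw_alt w_odd; have [ps E] := pair_wordP xw_alt w_odd x_true.
rewrite E word_prod_pair_word; case: ps E => [|p ps] // _.
(* The list of pairs is rewritten as a family indexed by ordinals, the form in which the cyclic
   tensors are given. *)
have -> : p :: ps = [seq ((nth p (p :: ps) i).1, (nth p (p :: ps) i).2)
    | i : 'I_(size ps).+1 <- enum 'I_(size ps).+1].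
  apply: (@eq_from_nth _ p) => [|i i_ps].
    by rewrite size_map size_enum_ord.
  by rewrite (nth_map ord0) ?size_enum_ord // nth_enum_ord //; case: (nth _ _ _).
rewrite even_pair_word FE big_map; congr cocenter_class.
by rewrite /index_enum -enumT.
Qed.

Theorem proposition2p1
  (k : fieldType) (char0 : [pchar k] =i pred0)
  (A B : algType k)
  (A0 : submodClosed A) (decA : complements_unit A0)
  (B0 : submodClosed B) (decB : complements_unit B0)
  (P : algType k) (iA : {lrmorphism A -> P}) (iB : {lrmorphism B -> P})
  (freeP : is_free_product iA iB) :
  exists phi : {linear cocenter P ->
                 (glued_cocenters A B * direct_sum (cyclic_words A0 B0))%type},
    [/\ bijective phi,
        forall a : A,
          phi (cocenter_class (iA a)) = (glued_class (cocenter_class a, 0), 0),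
        forall b : B,
          phi (cocenter_class (iB b)) = (glued_class (0, cocenter_class b), 0)
      & forall (n : nat) (a : 'I_n.+1 -> subspace A0)
               (b : 'I_n.+1 -> subspace B0),
          phi (cocenter_class (\prod_(i < n.+1) (iA (val (a i)) * iB (val (b i)))))
          = (0, direct_sum_in (cyclic_words A0 B0) n
                  (cyclic_class (tensors [ffun i => tens (a i) (b i)])))].
Proof.
have [epsA [redA [splitA epsA0 epsA1]]] := complement_split decA.
have [epsB [redB [splitB epsB0 epsB1]]] := complement_split decB.
pose eps s : {scalar factor A B s} :=
  match s with true => epsA | false => epsB end.
pose red s : {linear factor A B s -> subspace (factor_compl A0 B0 s)} :=
  match s with true => redA | false => redB end.
have split_unit s x : x = (eps s x)%:A + val (red s x) by case: s x.
have eps_val s (u : subspace (factor_compl A0 B0 s)) : eps s (val u) = 0.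
  by case: s u.
have eps1 s : eps s 1 = 1 by case: s.
(* The universal property is restated for the family of factors indexed by [bool]. *)
have coprodP : is_coproduct (factor_incl iA iB).
  move=> C f; have [h [[hA hB] h_uniq]] := freeP C (f true) (f false).
  exists h; split=> [[] x|h' h'E]; [exact: hA|exact: hB|].
  by apply: h_uniq => x; [exact: (h'E true)|exact: (h'E false)].
pose W := (glued_cocenters A B * direct_sum (cyclic_words A0 B0))%type.
pose even_form w : W := (0, @even_cyclic_word k A B A0 B0 w).
have [psi [psi_unit psi_cyc]] := inverse_exists A0 B0 iA iB.
have [|||||||||phi [phi_bij phi_unit phi_even]] :=
  @cocenter_iso k (factor A B) (factor_compl A0 B0) eps red split_unit eps_val
    eps1 P (factor_incl iA iB) coprodP W
    (@glued_part k A B A0 B0) even_form psi.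
- exact: glued_part_linear.
- exact: glued_part_trace.
- exact: glued_part_unit.
- move=> u t c x y v uv_odd.
  by rewrite /even_form even_cyclic_word_lin // pair0r_linear.
- by move=> x w w_odd; rewrite /even_form even_cyclic_word_rot.
(* The cyclic summands are spanned by tensors of pure tensors, and each of these is the value of
   [even_form] on a word of pairs. *)
- move=> Q Q_lin Q_unit Q_even; apply: target_ind => // n a b.
  have [x [w [w_alt w_odd _ <-]]] := even_pair_wordP a b.
  exact: Q_even.
- exact: linearP.
- exact: psi_unit.
- exact: (@even_word_class k A B P A0 B0 iA iB (fun d => psi (0, d))).
exists phi; split=> // [a|b|n a b].
- exact: (phi_unit true).
- exact: (phi_unit false).
have [x [w [w_alt w_odd w_pair w_cyc]]] := even_pair_wordP a b.
have := phi_even x w w_alt w_odd; rewrite /even_form w_cyc w_pair.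
by rewrite word_prod_pair_word big_map /index_enum -enumT.
Qed.
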